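(* Let $2\le q<\infty$, $\tau_0>0$, let $\mu$ be a positive regular Borel measure on $\mathbb{C}_+$, and assume that $\mathcal{L}\colon L^\infty(0,\tau_0)\to L^q(\mathbb{C}_+,d\mu)$ is bounded. Then there exists an $N$-function $\Phi\colon[0,\infty)\to[0,\infty)$ for which $\mathcal{L}\colon L^\Phi(0,\tau_0)\to L^q(\mathbb{C}_+,d\mu)$ is bounded.
   Context: $\mathbb{C}_+=\{z\in\mathbb{C}:\operatorname{Re}z>0\}$. The Laplace transform of a function $f$ on $(0,\infty)$ is $\mathcal{L}f(z)=\int_0^\infty e^{-zt}f(t)\,dt$, $z\in\mathbb{C}_+$; a function on $(0,\tau_0)$ is extended by $0$ to $(0,\infty)$. A Young function is a function $\Phi\colon[0,\infty)\to[0,\infty]$ of the form $\Phi(t)=\int_0^t\phi(s)\,ds$, where $\phi\colon[0,\infty)\to[0,\infty]$ is nondecreasing, left-continuous, and neither constantly $0$ nor constantly $+\infty$. An $N$-function is a real-valued (finite) Young function $\Phi$ with $\lim_{x\to0}\Phi(x)/x=\lim_{x\to\infty}x/\Phi(x)=0$. For an interval $J\subseteq\mathbb{R}$, $L^\Phi(J)$ is the space of measurable $f\colon J\to\mathbb{C}$ for which $\Phi(k^{-1}|f|)$ is integrable for some $k>0$, with norm $\|f\|_{L^\Phi}=\inf\{k>0:\int_J\Phi(k^{-1}|f(s)|)\,ds\le1\}$. *)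

(* Defs.v *)
From HB Require Import structures.
From mathcomp Require Import all_boot all_order all_algebra.
From mathcomp Require Import complex.
From mathcomp Require Import all_classical all_reals all_analysis.
Set Implicit Arguments.
Unset Strict Implicit.
Unset Printing Implicit Defensive.
Import Order.TTheory GRing.Theory Num.Theory.
Import numFieldNormedType.Exports.
Local Open Scope classical_set_scope.
Local Open Scope ring_scope.
Local Open Scope complex_scope.

Definition borel (T : ptopologicalType) := g_sigma_algebraType (@open T).

(* The topology of [R[i]] is carried by its alias [R[i]^o]; its balls are
   indexed by the positive elements of [R[i]], i.e. the positive reals. *)
Definition borelC (R : realType) := borel R[i]^o.

Definition Cplus_set (R : realType) : set R[i]^o :=
  [set z : R[i] | 0 < complex.Re z].

Definition Cplus (R : realType) : Type := set_type (@Cplus_set R).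

HB.instance Definition _ (R : realType) :=
  Topological.copy (Cplus R) (set_type (@Cplus_set R)).

Lemma Cplus1 (R : realType) : (1 : R[i]^o) \in @Cplus_set R.
Proof. by apply/mem_set; rewrite /Cplus_set /= ltr01. Qed.

HB.instance Definition _ (R : realType) :=
  isPointed.Build (Cplus R) (exist _ 1 (Cplus1 R)).

Definition Cplus_val (R : realType) (z : Cplus R) : R[i] := sval z.

(* Outer and inner regularity of every Borel set; finiteness on compact sets
   is not required. *)
Definition regular_measure (R : realType) (T : ptopologicalType)
    (mu : {measure set (borel T) -> \bar R}) : Prop :=
  forall A : set (borel T), measurable A ->
    mu A = ereal_inf [set mu U | U in [set U : set T | open U /\ A `<=` U]] /\
    mu A = ereal_sup [set mu K | K in [set K : set T | compact K /\ K `<=` A]].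

Section complex_valued_functions.
Context {R : realType}.
Implicit Types (D : set R) (J : interval R) (f g : R -> R[i]).

Definition cexp (z : R[i]) : R[i] :=
  (expR (complex.Re z))%:C *
  (cos (complex.Im z) +i* sin (complex.Im z)).

(* [Normc.normc] is the modulus with values in [R]; the norm [`|z|] of the
   library has values in [R[i]]. *)
Definition cmod (z : R[i]) : R := ComplexField.Normc.normc z.

Definition Cmeasurable d (T : measurableType d) (D : set T) (F : T -> R[i]) :=
  measurable_fun D (F : T -> borelC R).

Definition Cintegrable D g : Prop :=
  Cmeasurable D g /\
  (@lebesgue_measure R).-integrable D (fun t => (cmod (g t))%:E).

Definition Cintegral D g : R[i] :=
  (\int[@lebesgue_measure R]_(t in D) complex.Re (g t))
  +i* (\int[@lebesgue_measure R]_(t in D) complex.Im (g t)).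

(* A function on [J] is represented by an arbitrary function on [R] of which
   only the values on [J] are used. *)
Definition extend0 J f : R -> R[i] := patch (fun=> 0) [set` J] f.

Definition laplace_integrand f (z : R[i]) (t : R) : R[i] :=
  cexp (- (z * t%:C)) * f t.

Definition laplace f (z : R[i]) : R[i] :=
  Cintegral `]0, +oo[ (laplace_integrand f z).

Definition Linfty_norm J f : \bar R :=
  Lnorm (mrestr (@lebesgue_measure R) (measurable_itv J)) +oo%E (fun t => (cmod (f t))%:E).

Definition Linfty J : set (R -> R[i]) :=
  [set f | Cmeasurable [set` J] f /\ (Linfty_norm J f < +oo)%E].

Definition young_density (phi : R -> \bar R) : Prop :=
  [/\ forall s : R, 0 <= s -> (0 <= phi s)%E,
      forall s t : R, 0 <= s -> s <= t -> (phi s <= phi t)%E,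
      forall s : R, 0 < s -> phi x @[x --> s^'-] --> phi s,
      ~ (forall s : R, 0 <= s -> phi s = 0%E) &
      ~ (forall s : R, 0 <= s -> phi s = +oo%E)].

(* Young functions live on the half-line: values at negative arguments are
   irrelevant. *)
Definition young_function (Phi : R -> \bar R) : Prop :=
  exists2 phi : R -> \bar R, young_density phi &
    forall t, 0 <= t ->
      Phi t = (\int[@lebesgue_measure R]_(s in `[0%R, t]) phi s)%E.

Definition N_function (Phi : R -> R) : Prop :=
  [/\ young_function (EFin \o Phi),
      Phi x / x @[x --> 0^'+] --> 0 &
      x / Phi x @[x --> +oo] --> 0].

Definition orlicz (Phi : R -> \bar R) J : set (R -> R[i]) :=
  [set f | Cmeasurable [set` J] f /\
    exists2 k : R, 0 < k &
      (@lebesgue_measure R).-integrable [set` J]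
        (fun s => Phi (k^-1 * cmod (f s)))].

Definition luxemburg_norm (Phi : R -> \bar R) J f : \bar R :=
  ereal_inf [set k%:E | k in [set k : R | 0 < k /\
    (\int[@lebesgue_measure R]_(s in [set` J]) Phi (k^-1 * cmod (f s))%R <= 1)%E]].

Definition Lq_norm (mu : {measure set (borel (Cplus R)) -> \bar R}) (q : R)
    (F : Cplus R -> R[i]) : \bar R :=
  Lnorm mu q%:E (fun z => (cmod (F z))%:E).

Definition Lq (mu : {measure set (borel (Cplus R)) -> \bar R}) (q : R) :
    set (Cplus R -> R[i]) :=
  [set F | Cmeasurable (setT : set (borel (Cplus R))) F /\
    (Lq_norm mu q F < +oo)%E].

(* [X] is a space of functions on [J] and [normX] its norm. Boundedness
   includes that the Laplace integral converges absolutely at each point of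
   the half-plane and that the transform belongs to the target space. *)
Definition laplace_bounded J (X : set (R -> R[i]))
    (normX : (R -> R[i]) -> \bar R)
    (mu : {measure set (borel (Cplus R)) -> \bar R}) (q : R) : Prop :=
  exists M : R, forall f, X f ->
    let Lf := fun z : Cplus R => laplace (extend0 J f) (Cplus_val z) in
    [/\ forall z : Cplus R, Cintegrable `]0, +oo[
          (laplace_integrand (extend0 J f) (Cplus_val z)),
        Lq mu q Lf &
        (Lq_norm mu q Lf <= M%:E * normX f)%E].

End complex_valued_functions.

(* Main.v *)
Require Import Defs.
From mathcomp Require Import all_boot all_order all_algebra.
From mathcomp Require Import complex.
From mathcomp Require Import all_classical all_reals all_analysis.
From mathcomp Require Import measurable_realfun ess_sup_inf.
From mathcomp Require Import ring lra.
Set Implicit Arguments.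
Unset Strict Implicit.
Unset Printing Implicit Defensive.
Import Order.TTheory GRing.Theory Num.Theory.
Import numFieldNormedType.Exports.
Local Open Scope classical_set_scope.
Local Open Scope ring_scope.

(** The theorem rests on one soft fact: a bounded operator from [L^oo(J)] to
    [L^q(mu)], with [q >= 2], is automatically absolutely continuous. Write
    [N f] for the integral of [|L f|^q] against [mu], and let the capacity of a
    set [E] be the supremum of [N f] over the [f] that are bounded by 1 and vanish
    off [E]. All capacities are finite, by boundedness on [L^oo].

    For [q >= 2], Clarkson's inequality
    [2 (|a|^q + |b|^q) <= |a + b|^q + |a - b|^q] gives
    [2 (N f + N g) <= N (f + g) + N (f - g)]. If [f] and [g] have disjoint supports
    and are bounded by 1, so are [f + g] and [f - g]; hence capacity is
    superadditive on disjoint sets ([capacity_superadditive]). As [N] is lower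
    semicontinuous by Fatou's lemma, a gliding hump argument then shows that the
    capacity of [E] tends to 0 with the Lebesgue measure of [E]
    ([capacity_small]).

    Choose [delta j] such that sets of measure at most [delta j] have capacity at
    most a constant over [(2^(2j+3))^q], and an N-function [Phi] that grows so fast
    that [Phi (2^j) >= 1 / delta j] ([fast_N_function]). If the integral of
    [Phi |f|] over [J] is at most 1, then by Markov's inequality the dyadic level
    set [2^j <= |f| < 2^(j+1)] has measure at most [delta j], so that the part of
    [f] on it, multiplied by [2^(j+2)], has bounded [N]. Since [f] is a convex
    combination, with weights [2^-(j+2)] and [1 / 2], of these multiples and of
    twice its part where [|f| < 1], convexity of [N] bounds [N f], Fatou's lemma
    allowing the passage from the truncations of [f] to [f] itself
    ([energy_unit_ball]).
    Homogeneity turns this into a bound by the Luxemburg norm.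

    Besides measurability, the only property of the Laplace kernel that is used
    is the bound [|exp (- z t)| <= 1]. *)

(** * Modulus, powers and measurability of complex functions *)

Section modulus.
Context {R : realType}.
Implicit Types a b : R[i].

Lemma cmodE a : cmod a = Num.sqrt (complex.Re a ^+ 2 + complex.Im a ^+ 2).
Proof. by case: a. Qed.

Lemma cmod_ge0 a : 0 <= cmod a.
Proof. by rewrite cmodE sqrtr_ge0. Qed.

Lemma cmod0 : cmod (0 : R[i]) = 0.
Proof. exact: ComplexField.Normc.normc0. Qed.

Lemma cmodM a b : cmod (a * b) = cmod a * cmod b.
Proof. exact: ComplexField.Normc.normcM. Qed.

Lemma cmodD a b : cmod (a + b) <= cmod a + cmod b.
Proof. exact: le_normcD. Qed.

Lemma cmodN a : cmod (- a) = cmod a.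
Proof. exact: normcN. Qed.

Lemma cmod_real (c : R) : cmod c%:C%C = `|c|.
Proof. by rewrite cmodE /= expr0n addr0 sqrtr_sqr. Qed.

Lemma sqr_cmod a : cmod a ^+ 2 = complex.Re a ^+ 2 + complex.Im a ^+ 2.
Proof. by rewrite cmodE sqr_sqrtr// addr_ge0// sqr_ge0. Qed.

Lemma normr_Re_le_cmod a : `|complex.Re a| <= cmod a.
Proof.
by rewrite cmodE -sqrtr_sqr ler_wsqrtr// lerDl sqr_ge0.
Qed.

Lemma normr_Im_le_cmod a : `|complex.Im a| <= cmod a.
Proof.
by rewrite cmodE -sqrtr_sqr ler_wsqrtr// lerDr sqr_ge0.
Qed.

Lemma cmod_le_ReIm a : cmod a <= `|complex.Re a| + `|complex.Im a|.
Proof.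
have h : 0 <= `|complex.Re a| + `|complex.Im a| by rewrite addr_ge0.
rewrite -[leRHS]ger0_norm// -sqrtr_sqr cmodE ler_wsqrtr//.
rewrite sqrrD !real_normK ?num_real// addrAC lerDl.
by rewrite mulrn_wge0// mulr_ge0.
Qed.

Lemma cmod_parallelogram a b :
  cmod (a + b) ^+ 2 + cmod (a - b) ^+ 2 = 2 * (cmod a ^+ 2 + cmod b ^+ 2).
Proof. by rewrite !sqr_cmod; case: a b => [a1 a2] [b1 b2] /=; ring. Qed.

End modulus.

Section powR_facts.
Context {R : realType}.
Implicit Types x y p : R.

Lemma powR_midpoint p x y : 1 <= p -> 0 <= x -> 0 <= y ->
  (2^-1 * (x + y)) `^ p <= 2^-1 * (x `^ p + y `^ p).
Proof.
move=> p1 x0 y0; rewrite !mulrDr.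
have e : (2^-1 : R) = 1 - 2^-1 by lra.
rewrite {2 4}e.
apply: (convex_powR p1 (Itv01 _ _)) => //=;
  by rewrite ?inE/= ?in_itv/= ?x0 ?y0//; lra.
Qed.

Lemma powR_superadditive p x y : 1 <= p -> 0 <= x -> 0 <= y ->
  x `^ p + y `^ p <= (x + y) `^ p.
Proof.
move=> p1 x0 y0; have p0 : 0 < p by exact: lt_le_trans p1.
have h (u v : R) : 0 <= u -> 0 <= v -> 0 < u + v ->
    u `^ p <= u / (u + v) * (u + v) `^ p.
  move=> u0 v0 s0; have [->|un0] := eqVneq u 0.
    by rewrite powR0 ?gt_eqF// !mul0r.
  rewrite -[in leLHS](mulfVK (lt0r_neq0 s0) u).
  apply: ge1r_powRZ => //; last exact: ltW.
  have u_gt0 : 0 < u by rewrite lt0r un0.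
  by rewrite divr_gt0//= ler_pdivrMr// mul1r lerDl.
have [/eqP|s0] := eqVneq (x + y) 0.
  rewrite paddr_eq0// => /andP[/eqP-> /eqP->].
  by rewrite addr0 powR0 ?gt_eqF// addr0.
have {}s0 : 0 < x + y by rewrite lt0r s0 addr_ge0.
apply: le_trans (lerD (h x y x0 y0 s0) (h y x y0 x0 _)) _.
  by rewrite addrC.
by rewrite (addrC y x) -!mulrDl divff ?gt_eqF// mul1r.
Qed.

(** Clarkson's inequality for complex numbers: the parallelogram identity,
    combined with the convexity and the superadditivity of the power [q / 2]. *)
Lemma clarkson q (a b : R[i]) : 2 <= q ->
  2 * (cmod a `^ q + cmod b `^ q) <= cmod (a + b) `^ q + cmod (a - b) `^ q.
Proof.
move=> q2.
have sq (c : R[i]) : cmod c `^ q = (cmod c ^+ 2) `^ (q / 2).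
  rewrite -powR_mulrn ?cmod_ge0// -powRrM; congr (_ `^ _); lra.
have q1 : 1 <= q / 2 by lra.
rewrite !sq.
set A := cmod (a + b) ^+ 2; set B := cmod (a - b) ^+ 2.
have A0 : 0 <= A by rewrite sqr_ge0.
have B0 : 0 <= B by rewrite sqr_ge0.
have h1 := powR_midpoint q1 A0 B0.
have h2 : 2^-1 * (A + B) = cmod a ^+ 2 + cmod b ^+ 2.
  by rewrite /A /B cmod_parallelogram; lra.
rewrite h2 in h1.
have h3 := powR_superadditive q1 (sqr_ge0 (cmod a)) (sqr_ge0 (cmod b)).
lra.
Qed.

End powR_facts.

Section borelC_measurability.
Context d {T : measurableType d} {R : realType}.
Implicit Types (D : set T) (F G : T -> R[i]).

Lemma open_borelC_preimage (h : R[i] -> R) (U : set R) :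
  (forall a b, `|h a - h b| <= cmod (a - b)) -> open U ->
  open (h @^-1` U : set R[i]^o).
Proof.
move=> hl oU; rewrite openE => a /= Ua.
have := open_nbhs_nbhs (conj oU Ua); rewrite -nbhs_ballE => -[e /= e0 eU].
rewrite /interior -nbhs_ballE; exists e%:C%C; first by rewrite /= ltcR.
move=> b; rewrite -ball_normE /= => ab.
apply: eU; rewrite -ball_normE /=; apply: le_lt_trans (hl _ _) _.
by rewrite -ltcR.
Qed.

Lemma measurable_lipschitz_comp D F (h : R[i] -> R) :
  (forall a b, `|h a - h b| <= cmod (a - b)) ->
  Cmeasurable D F -> measurable_fun D (h \o F).
Proof.
move=> hl mF mD.
have mh : measurable_fun [set: borelC R] (h : borelC R -> R).
  apply: (measurability _ (RGenOpens.measurableE R)) => _ [_ [x [y ->]] <-].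
  rewrite setTI; apply: sub_sigma_algebra.
  by apply: open_borelC_preimage hl _; exact: interval_open.
exact: (measurableT_comp mh mF).
Qed.

(** Borel measurability into the complex plane is measurability of the real and
    imaginary parts. *)
Lemma CmeasurableP D F : measurable D ->
  Cmeasurable D F <-> measurable_fun D (fun t => complex.Re (F t)) /\
    measurable_fun D (fun t => complex.Im (F t)).
Proof.
move=> mD; split=> [mF|[mRe mIm]].
  split; apply: (@measurable_lipschitz_comp D F) => // a b.
  - by rewrite -raddfB normr_Re_le_cmod.
  - by rewrite -raddfB normr_Im_le_cmod.
apply: (@measurability _ _ T (borelC R) D F (@open R[i]^o) erefl) => //.
move=> _ [U oU <-].
(* [U] is the countable union of the rational open rectangles that it contains. *)
pose rect (r : (rat * rat) * (rat * rat)) : set R[i] :=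
  [set a | (ratr r.1.1 < complex.Re a < ratr r.1.2) &&
           (ratr r.2.1 < complex.Im a < ratr r.2.2)].
have -> : D `&` F @^-1` U =
    \bigcup_(r in [set r | rect r `<=` U]) (D `&` F @^-1` (rect r)).
  apply/seteqP; split=> [t [Dt Ut]|t [r /= rU [Dt /rU Ut]]]; last by split.
  have := open_nbhs_nbhs (conj oU Ut); rewrite -nbhs_ballE => -[e /= e0 eU].
  have [r r0 er] : exists2 r : R, 0 < r & e = r%:C%C.
    by case: e e0 {eU} => r i; rewrite ltcE /= => /andP[/eqP-> r0]; exists r.
  have r20 : 0 < r / 2 by rewrite divr_gt0.
  have rat_near (x : R) : exists p : rat * rat,
      (ratr p.1 < x < ratr p.2) /\ x - r / 2 < ratr p.1 /\ ratr p.2 < x + r / 2.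
    have [q1 /andP[]] := @rat_in_itvoo R (x - r / 2) x ltac:(lra).
    have [q2 /andP[]] := @rat_in_itvoo R x (x + r / 2) ltac:(lra).
    by rewrite ?bnd_simp => ? ? ? ?; exists (q1, q2); split=> //=; apply/andP.
  have [p [p1 [p2 p3]]] := rat_near (complex.Re (F t)).
  have [p' [p1' [p2' p3']]] := rat_near (complex.Im (F t)).
  exists (p, p'); last by split=> //; apply/andP.
  move=> a /andP[/= /andP[? ?] /andP[? ?]]; apply: eU.
  rewrite -ball_normE /= er -[`|_|]/((cmod (F t - a))%:C%C) ltcR.
  apply: le_lt_trans (cmod_le_ReIm _) _; rewrite !raddfB/=.
  have lt_half (u v : R) : v - r / 2 < u -> u < v + r / 2 -> `|v - u| < r / 2.
    by move=> ? ?; rewrite ltr_norml; apply/andP; split; lra.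
  move: p1 p1' => /andP[? ?] /andP[? ?].
  by rewrite [ltRHS](splitr r) ltrD// lt_half//; lra.
rewrite bigcup_mkcond; apply: countable_bigcupT_measurable.
  exact: countableP.
move=> r; case: ifPn => // _.
rewrite (_ : _ `&` _ =
  (D `&` (fun t => complex.Re (F t)) @^-1` `]ratr r.1.1, ratr r.1.2[) `&`
  (D `&` (fun t => complex.Im (F t)) @^-1` `]ratr r.2.1, ratr r.2.2[)); last first.
  apply/seteqP; split=> t.
    by move=> [Dt /andP[h1 h2]]; split; split; rewrite //= in_itv.
  move=> [[Dt +] [_ +]]; rewrite /= !in_itv /= => h1 h2.
  by split=> //; apply/andP.
by apply: measurableI; [apply: mRe|apply: mIm].
Qed.


Lemma measurable_cmod D F :
  Cmeasurable D F -> measurable_fun D (fun t => cmod (F t)).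
Proof.
apply: measurable_lipschitz_comp => a b.
have := cmodD (a - b) b; rewrite subrK => h1.
have := cmodD (b - a) a; rewrite subrK -(cmodN (b - a)) opprB => h2.
by rewrite ler_norml; apply/andP; split; lra.
Qed.

Lemma CmeasurableD D F G : measurable D -> Cmeasurable D F -> Cmeasurable D G ->
  Cmeasurable D (fun t => F t + G t).
Proof.
move=> mD /CmeasurableP-/(_ mD)[F1 F2] /CmeasurableP-/(_ mD)[G1 G2].
apply/CmeasurableP => //; split.
- under [X in measurable_fun _ X]eq_fun do rewrite raddfD.
  exact: measurable_funD.
- under [X in measurable_fun _ X]eq_fun do rewrite raddfD.
  exact: measurable_funD.
Qed.

Lemma CmeasurableM D F G : measurable D -> Cmeasurable D F -> Cmeasurable D G ->
  Cmeasurable D (fun t => F t * G t).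
Proof.
move=> mD /CmeasurableP-/(_ mD)[F1 F2] /CmeasurableP-/(_ mD)[G1 G2].
apply/CmeasurableP => //; split.
- apply: (@eq_measurable_fun _ _ _ _ _ (fun t =>
    complex.Re (F t) * complex.Re (G t) - complex.Im (F t) * complex.Im (G t))).
    by move=> t _; case: (F t) => ? ?; case: (G t).
  by apply: measurable_funB; exact: measurable_funM.
- apply: (@eq_measurable_fun _ _ _ _ _ (fun t =>
    complex.Re (F t) * complex.Im (G t) + complex.Im (F t) * complex.Re (G t))).
    by move=> t _; case: (F t) => ? ?; case: (G t).
  by apply: measurable_funD; exact: measurable_funM.
Qed.

Lemma Cmeasurable_patch D E F : measurable D -> measurable E ->
  Cmeasurable (D `&` E) F -> Cmeasurable D (patch (fun=> 0) E F).
Proof.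
move=> mD mE /CmeasurableP-/(_ (measurableI _ _ mD mE))[F1 F2].
apply/CmeasurableP => //; split.
- apply: (@eq_measurable_fun _ _ _ _ _ ((fun t => complex.Re (F t)) \_ E)).
    by move=> t _; rewrite /patch; case: ifP.
  exact: (measurable_restrict _ mE mD).1 F1.
- apply: (@eq_measurable_fun _ _ _ _ _ ((fun t => complex.Im (F t)) \_ E)).
    by move=> t _; rewrite /patch; case: ifP.
  exact: (measurable_restrict _ mE mD).1 F2.
Qed.

Lemma Cmeasurable_cst D (c : R[i]) : Cmeasurable D (fun=> c).
Proof. exact: measurable_cst. Qed.

Lemma CmeasurableB D F G : measurable D -> Cmeasurable D F -> Cmeasurable D G ->
  Cmeasurable D (fun t => F t - G t).
Proof.
move=> mD mF mG.
have -> : (fun t => F t - G t) = (fun t => F t + (-1) * G t).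
  by apply/funext => t; rewrite mulN1r.
apply: CmeasurableD => //; apply: CmeasurableM => //; exact: Cmeasurable_cst.
Qed.

End borelC_measurability.

(** * The Laplace transform of integrable functions *)

Section complex_integral.
Context {R : realType}.
Notation lam := (@lebesgue_measure R).
Implicit Types (D E : set R) (g h : R -> R[i]).

Lemma Cintegrable_Re D g : measurable D -> Cintegrable D g ->
  lam.-integrable D (EFin \o (fun t => complex.Re (g t))).
Proof.
move=> mD [/CmeasurableP-/(_ mD)[mg _]]; apply: le_integrable => //.
  exact/measurable_EFinP.
by move=> t _; rewrite lee_fin [leRHS]ger0_norm ?cmod_ge0// normr_Re_le_cmod.
Qed.

Lemma Cintegrable_Im D g : measurable D -> Cintegrable D g ->
  lam.-integrable D (EFin \o (fun t => complex.Im (g t))).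
Proof.
move=> mD [/CmeasurableP-/(_ mD)[_ mg]]; apply: le_integrable => //.
  exact/measurable_EFinP.
by move=> t _; rewrite lee_fin [leRHS]ger0_norm ?cmod_ge0// normr_Im_le_cmod.
Qed.

Lemma Cintegrable_le D g h : measurable D -> Cmeasurable D g ->
  (forall t, D t -> cmod (g t) <= cmod (h t)) -> Cintegrable D h ->
  Cintegrable D g.
Proof.
move=> mD mg gh [mh ih]; split=> //; apply: le_integrable ih => //.
  by apply/measurable_EFinP; exact: measurable_cmod.
by move=> t Dt; rewrite lee_fin !ger0_norm ?cmod_ge0 ?gh.
Qed.

Lemma CintegrableD D g h : measurable D -> Cintegrable D g -> Cintegrable D h ->
  Cintegrable D (fun t => g t + h t).
Proof.
move=> mD [mg ig] [mh ih]; split; first exact: CmeasurableD.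
apply: (@le_integrable _ _ _ lam D mD _
  (fun t => (cmod (g t))%:E + (cmod (h t))%:E)%E); last exact: integrableD.
  by apply/measurable_EFinP/measurable_cmod; exact: CmeasurableD.
move=> t _; rewrite -EFinD lee_fin !ger0_norm ?addr_ge0 ?cmod_ge0//.
exact: cmodD.
Qed.

Lemma CintegrableZ D g (c : R) : measurable D -> Cintegrable D g ->
  Cintegrable D (fun t => c%:C%C * g t).
Proof.
move=> mD [mg ig]; split.
  by apply: CmeasurableM => //; exact: Cmeasurable_cst.
rewrite (_ : (fun t => _) = (fun t => `|c|%:E * (cmod (g t))%:E)%E).
  exact: integrableZl.
by apply/funext => t; rewrite cmodM cmod_real EFinM.
Qed.

Lemma CintegralD D g h : measurable D -> Cintegrable D g -> Cintegrable D h ->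
  Cintegral D (fun t => g t + h t) = Cintegral D g + Cintegral D h.
Proof.
move=> mD ig ih; rewrite /Cintegral.
under eq_Rintegral do rewrite raddfD.
under [X in (_ +i* X)%C = _]eq_Rintegral do rewrite raddfD.
rewrite RintegralD//; [|exact: Cintegrable_Re..].
by rewrite RintegralD//; exact: Cintegrable_Im.
Qed.

Lemma CintegralZ D g (c : R) : measurable D -> Cintegrable D g ->
  Cintegral D (fun t => c%:C%C * g t) = c%:C%C * Cintegral D g.
Proof.
move=> mD ig; rewrite /Cintegral.
have e1 t : complex.Re (c%:C%C * g t) = c * complex.Re (g t).
  by case: (g t) => a b /=; rewrite mul0r subr0.
have e2 t : complex.Im (c%:C%C * g t) = c * complex.Im (g t).
  by case: (g t) => a b /=; rewrite mul0r addr0.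
under eq_Rintegral do rewrite e1.
under [X in (_ +i* X)%C = _]eq_Rintegral do rewrite e2.
rewrite RintegralZl//; last exact: Cintegrable_Re.
rewrite RintegralZl//; last exact: Cintegrable_Im.
by apply/eqP; rewrite eq_complex /= !mul0r subr0 addr0 !eqxx.
Qed.

(** The factor 2, which is not optimal, comes from bounding the real and
    imaginary parts separately. *)
Lemma cmod_Cintegral_le D g : measurable D -> Cintegrable D g ->
  ((cmod (Cintegral D g))%:E <= 2%:E * \int[lam]_(t in D) (cmod (g t))%:E)%E.
Proof.
move=> mD ig.
have fin : (\int[lam]_(t in D) (cmod (g t))%:E)%E \is a fin_num.
  by apply: integrable_fin_num => //; case: ig.
rewrite -(fineK fin) -EFinM lee_fin.
apply: le_trans (cmod_le_ReIm _) _; rewrite mulr_natl mulr2n /Cintegral /=.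
have Nint : lam.-integrable D (EFin \o (fun t => cmod (g t))) by case: ig.
apply: lerD.
- have iR := Cintegrable_Re mD ig.
  apply: le_trans (le_normr_Rintegral _ iR) _ => //. 
  apply: le_Rintegral => //; first exact: integrable_norm.
  by move=> t _; exact: normr_Re_le_cmod.
- have iI := Cintegrable_Im mD ig.
  apply: le_trans (le_normr_Rintegral _ iI) _ => //.
  apply: le_Rintegral => //; first exact: integrable_norm.
  by move=> t _; exact: normr_Im_le_cmod.
Qed.

Lemma cmod_cexp (z : R[i]) : cmod (cexp z) = expR (complex.Re z).
Proof.
rewrite /cexp cmodM cmod_real ger0_norm ?expR_ge0//.
by rewrite cmodE /= cos2Dsin2 sqrtr1 mulr1.
Qed.

Lemma Cmeasurable_cexp D (z : R[i]) : measurable D ->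
  Cmeasurable D (fun t => cexp (- (z * t%:C%C))).
Proof.
move=> mD.
have e t : cexp (- (z * t%:C%C)) =
    ((expR (- complex.Re z * t))%:C *
     (cos (- complex.Im z * t) +i* sin (- complex.Im z * t)))%C.
  rewrite /cexp; case: z => x y /=.
  by congr (_%:C * (cos _ +i* sin _))%C; [congr expR| |]; ring.
have mlin (a : R) : measurable_fun [set: R] (fun t => a * t).
  by apply: measurable_funM => //; exact: measurable_cst.
apply: (@measurable_funS _ _ _ _ setT) => //.
under [X in measurable_fun _ X]eq_fun do rewrite e.
apply: CmeasurableM => //; apply/CmeasurableP => //; split => /=.
- by apply: measurableT_comp => //; exact: mlin.
- exact: measurable_cst.
- apply: measurableT_comp (mlin _).
  by apply: continuous_measurable_fun; exact: continuous_cos.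
- apply: measurableT_comp (mlin _).
  by apply: continuous_measurable_fun; exact: continuous_sin.
Qed.

End complex_integral.

Section laplace_transform.
Context {R : realType}.
Notation lam := (@lebesgue_measure R).
Variable J : interval R.
Hypothesis J0 : [set` J] `<=` `]0, +oo[.
Implicit Types (f g : R -> R[i]) (z : R[i]).

Let mJ : measurable [set` J]. Proof. exact: measurable_itv. Qed.

Lemma Cintegrable_extend0 f : Cintegrable [set` J] f ->
  Cintegrable `]0, +oo[ (extend0 J f).
Proof.
move=> [mf intf]; split.
  by apply: Cmeasurable_patch => //; rewrite setIidr.
have -> : (fun t => (cmod (extend0 J f t))%:E) =
          (fun t => (cmod (f t))%:E) \_ [set` J].
  by apply/funext => t; rewrite /extend0 /patch; case: ifP => //; rewrite cmod0.
by apply/integrable_restrict => //; rewrite setIidr.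
Qed.

Lemma integral_cmod_extend0 f :
  (\int[lam]_(t in `]0%R, +oo[) (cmod (extend0 J f t))%:E =
   \int[lam]_(t in [set` J]) (cmod (f t))%:E)%E.
Proof.
rewrite -[in RHS](setIidr J0) integral_mkcondr; apply: eq_integral => t _.
by rewrite /extend0 /patch; case: ifP => //; rewrite cmod0.
Qed.

Lemma cmod_laplace_integrand_le f z t : 0 < complex.Re z -> 0 < t ->
  cmod (laplace_integrand f z t) <= cmod (f t).
Proof.
move=> z0 t0; rewrite /laplace_integrand cmodM cmod_cexp ler_piMl ?cmod_ge0//.
rewrite -expR0 ler_expR; case: z z0 => x y /= x0.
by rewrite mulr0 subr0 oppr_le0 mulr_ge0// ltW.
Qed.

Lemma laplace_integrable f z : 0 < complex.Re z -> Cintegrable [set` J] f ->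
  Cintegrable `]0, +oo[ (laplace_integrand (extend0 J f) z).
Proof.
move=> z0 /Cintegrable_extend0 intf; apply: Cintegrable_le (intf) => //.
  by apply: CmeasurableM => //; [exact: Cmeasurable_cexp|case: intf].
by move=> t; rewrite /= in_itv/= andbT; exact: cmod_laplace_integrand_le.
Qed.

Lemma laplaceD f g z : 0 < complex.Re z ->
  Cintegrable [set` J] f -> Cintegrable [set` J] g ->
  laplace (extend0 J (fun t => f t + g t)) z =
  laplace (extend0 J f) z + laplace (extend0 J g) z.
Proof.
move=> z0 intf intg; rewrite /laplace.
rewrite -CintegralD//; [|exact: laplace_integrable..].
congr Cintegral; apply/funext => t.
rewrite /laplace_integrand /extend0 /patch.
case: ifP => _; first by rewrite mulrDr.
by rewrite !mulr0 addr0.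
Qed.

Lemma laplaceZ f (c : R) z : 0 < complex.Re z -> Cintegrable [set` J] f ->
  laplace (extend0 J (fun t => c%:C%C * f t)) z =
  c%:C%C * laplace (extend0 J f) z.
Proof.
move=> z0 intf; rewrite /laplace -CintegralZ//; last exact: laplace_integrable.
congr Cintegral; apply/funext => t.
rewrite /laplace_integrand /extend0 /patch.
case: ifP => _; last by rewrite !mulr0.
by rewrite mulrCA.
Qed.

Lemma cmod_laplace_le f z : 0 < complex.Re z -> Cintegrable [set` J] f ->
  ((cmod (laplace (extend0 J f) z))%:E <=
   2%:E * \int[lam]_(t in [set` J]) (cmod (f t))%:E)%E.
Proof.
move=> z0 intf.
apply: le_trans (cmod_Cintegral_le _ (laplace_integrable z0 intf)) _ => //.
rewrite -integral_cmod_extend0 lee_wpmul2l//.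
have [m1 _] := laplace_integrable z0 intf.
have [m2 _] := Cintegrable_extend0 intf.
apply: ge0_le_integral => //.
- by move=> t _; rewrite lee_fin cmod_ge0.
- by apply/measurable_EFinP; exact: measurable_cmod.
- by apply/measurable_EFinP; exact: measurable_cmod.
move=> t; rewrite /= in_itv/= andbT => t0; rewrite lee_fin.
exact: cmod_laplace_integrand_le.
Qed.

End laplace_transform.

(** * Energy: q-th powers of L^q norms *)

(** At [l = 0] the power function is continuous from the right only, hence the
    hypothesis that [u] is nonnegative. *)
Lemma powR_cvg (R : realType) (q l : R) (u : nat -> R) : 0 < q ->
  (forall n, 0 <= u n) -> u n @[n --> \oo] --> l ->
  u n `^ q @[n --> \oo] --> l `^ q.
Proof.
move=> q0 u0 ul.
have l0 : 0 <= l by apply: (cvgr_to_ge ul); exact: nearW.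
move: l0; rewrite le_eqVlt => /predU1P[l0|l0].
  rewrite -l0 powR0 ?gt_eqF//; rewrite -l0 in ul.
  apply/cvgrPdist_lt => e e0.
  have e'0 : 0 < e `^ q^-1 by exact: powR_gt0.
  move/cvgrPdist_lt : ul => /(_ _ e'0); apply: filterS => n.
  rewrite !sub0r !normrN !ger0_norm ?powR_ge0// => une.
  rewrite -[ltRHS]powRr1 ?ltW// -(mulVf (lt0r_neq0 q0)) powRrM.
  by rewrite gt0_ltr_powR ?nnegrE// ltW.
have cl : {for l, continuous (fun x : R => x `^ q)}.
  apply: differentiable_continuous; apply/derivable1_diffP.
  by apply: derivable_powR; rewrite in_itv /= andbT.
exact: (cvg_comp _ _ ul cl).
Qed.

Section energy.
Context d (T : measurableType d) (R : realType).
Variable mu : {measure set T -> \bar R}.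
Variable q : R.
Implicit Types (F G : T -> R[i]) (C : R).

(** The [q]-th power of the norm of [F] in [L^q(mu)]. *)
Definition energy F : \bar R := (\int[mu]_z ((cmod (F z)) `^ q)%:E)%E.

Lemma energy_ge0 F : (0 <= energy F)%E.
Proof. by apply: integral_ge0 => z _; rewrite lee_fin powR_ge0. Qed.

Lemma Lnorm_energy F :
  Lnorm mu q%:E (fun z => (cmod (F z))%:E) = (energy F `^ q^-1)%E.
Proof.
rewrite unlock; congr (_ `^ _)%E; apply: eq_integral => z _.
by rewrite /= ger0_norm ?cmod_ge0.
Qed.

Let measurable_powR_cmod F : Cmeasurable setT F ->
  measurable_fun setT (fun z => ((cmod (F z)) `^ q)%:E).
Proof.
move=> mF; apply/measurable_EFinP.
apply: (@measurableT_comp _ _ _ _ _ _ (@powR R ^~ q)) => //.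
exact: measurable_cmod.
Qed.

Lemma energyZ (c : R) F : Cmeasurable setT F ->
  energy (fun z => c%:C%C * F z) = ((`|c| `^ q)%:E * energy F)%E.
Proof.
move=> mF; rewrite /energy -ge0_integralZl//; last 2 first.
- exact: measurable_powR_cmod.
- by move=> z _; rewrite lee_fin powR_ge0.
apply: eq_integral => z _.
by rewrite cmodM cmod_real powRM ?cmod_ge0.
Qed.

(** A sublevel set of the energy is midpoint convex. *)
Lemma energy_midpoint_le F G C : 1 <= q ->
  Cmeasurable setT F -> Cmeasurable setT G ->
  (energy F <= C%:E)%E -> (energy G <= C%:E)%E ->
  (energy (fun z => (2^-1)%:C%C * (F z + G z))%R <= C%:E)%E.
Proof.
move=> q1 mF mG FC GC.
have q0 : 0 <= q by exact: le_trans q1.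
apply: (@le_trans _ _ ((2^-1)%:E * (energy F + energy G))%E); last first.
  apply: (@le_trans _ _ ((2^-1)%:E * (C%:E + C%:E))%E).
    by rewrite lee_wpmul2l ?lee_fin ?invr_ge0// leeD.
  by rewrite -EFinD -EFinM lee_fin; lra.
rewrite /energy -ge0_integralD//; last 4 first.
- by move=> z _; rewrite lee_fin powR_ge0.
- exact: measurable_powR_cmod.
- by move=> z _; rewrite lee_fin powR_ge0.
- exact: measurable_powR_cmod.
rewrite -ge0_integralZl//; last 2 first.
- by apply: emeasurable_funD; exact: measurable_powR_cmod.
- by move=> z _; rewrite -EFinD lee_fin addr_ge0 ?powR_ge0.
apply: ge0_le_integral => //.
- by move=> z _; rewrite lee_fin powR_ge0.
- apply: measurable_powR_cmod; apply: CmeasurableM => //.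
    exact: Cmeasurable_cst.
  exact: CmeasurableD.
- apply: measurable_funeM.
  by apply: emeasurable_funD; exact: measurable_powR_cmod.
move=> z _; rewrite -EFinD -EFinM lee_fin.
apply: le_trans (powR_midpoint q1 (cmod_ge0 _) (cmod_ge0 _)).
rewrite ge0_ler_powR ?nnegrE ?cmod_ge0//.
  by rewrite mulr_ge0 ?addr_ge0 ?cmod_ge0 ?invr_ge0.
by rewrite cmodM cmod_real ger0_norm ?invr_ge0// ler_wpM2l ?invr_ge0// cmodD.
Qed.

Lemma energy_clarkson F G : 2 <= q ->
  Cmeasurable setT F -> Cmeasurable setT G ->
  (2%:E * (energy F + energy G) <=
   energy (fun z => F z + G z)%R + energy (fun z => F z - G z)%R)%E.
Proof.
move=> q2 mF mG.
have mB : Cmeasurable setT (fun z => F z - G z) by exact: CmeasurableB.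
have mD : Cmeasurable setT (fun z => F z + G z) by exact: CmeasurableD.
rewrite /energy -!ge0_integralD//; try by move=> z _; rewrite lee_fin powR_ge0.
all: try exact: measurable_powR_cmod.
rewrite -ge0_integralZl//; last 2 first.
- by apply: emeasurable_funD; exact: measurable_powR_cmod.
- by move=> z _; rewrite -EFinD lee_fin addr_ge0 ?powR_ge0.
apply: ge0_le_integral => //.
- by move=> z _; rewrite -EFinD -EFinM lee_fin mulr_ge0 ?addr_ge0 ?powR_ge0.
- apply: measurable_funeM.
  by apply: emeasurable_funD; exact: measurable_powR_cmod.
- by apply: emeasurable_funD; exact: measurable_powR_cmod.
by move=> z _; rewrite -!EFinD -EFinM lee_fin; exact: clarkson.
Qed.

Lemma energy_fatou F (Fn : nat -> T -> R[i]) C : 0 < q ->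
  (forall n, Cmeasurable setT (Fn n)) ->
  (forall z, cmod (Fn n z) @[n --> \oo] --> cmod (F z)) ->
  (forall n, (energy (Fn n) <= C%:E)%E) -> (energy F <= C%:E)%E.
Proof.
move=> q0 mF cF FC.
pose e n z := ((cmod (Fn n z)) `^ q)%:E.
have -> : energy F = (\int[mu]_z limn_einf (e ^~ z))%E.
  apply: eq_integral => z _.
  suff /cvg_limn_einf_sup[-> //] :
      e n z @[n --> \oo] --> ((cmod (F z)) `^ q)%:E.
  apply: cvg_EFin; first exact: nearW.
  by apply: powR_cvg => // n; exact: cmod_ge0.
apply: le_trans (fatou mu measurableT _ _) _.
- by move=> n; exact: measurable_powR_cmod.
- by move=> n z _; rewrite lee_fin powR_ge0.
rewrite limn_einf_lim; apply: lime_le; first exact: is_cvg_einfs.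
apply: nearW => n; apply: le_trans (FC n).
by apply: ereal_inf_lbound; exists n => /=.
Qed.

End energy.

(** * Capacity and absolute continuity *)

Section absolute_continuity.
Context {R : realType}.
Notation lam := (@lebesgue_measure R).
Variables (q : R) (J : interval R).
Variable mu : {measure set (borel (Cplus R)) -> \bar R}.
Hypothesis q2 : 2 <= q.
Hypothesis J0 : [set` J] `<=` `]0, +oo[.
Hypothesis Jfin : (lam [set` J] < +oo)%E.
Hypothesis bounded_Linfty :
  laplace_bounded J (Linfty J) (Linfty_norm J) mu q.
Implicit Types (f g : R -> R[i]) (E : set R).

(** The Laplace transform of the restriction of [f] to [J]. *)
Definition Lap f (z : Cplus R) : R[i] := laplace (extend0 J f) (Cplus_val z).

Lemma Cplus_gt0 (z : Cplus R) : 0 < complex.Re (Cplus_val z).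
Proof. by case: z => z /= /set_mem. Qed.

Let q0 : 0 < q. Proof. exact: lt_le_trans q2. Qed.

Let mJ : measurable [set` J]. Proof. exact: measurable_itv. Qed.

Lemma LapD f g : Cintegrable [set` J] f -> Cintegrable [set` J] g ->
  Lap (fun t => f t + g t) = (fun z => Lap f z + Lap g z).
Proof.
move=> intf intg; apply/funext => z.
by rewrite /Lap laplaceD//; exact: Cplus_gt0.
Qed.

Lemma LapZ f (c : R) : Cintegrable [set` J] f ->
  Lap (fun t => c%:C%C * f t) = (fun z => c%:C%C * Lap f z).
Proof.
move=> intf; apply/funext => z.
by rewrite /Lap laplaceZ//; exact: Cplus_gt0.
Qed.

Lemma Lap_integrand_integrable f (z : Cplus R) : Cintegrable [set` J] f ->
  Cintegrable `]0, +oo[ (laplace_integrand (extend0 J f) (Cplus_val z)).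
Proof. by move=> intf; apply: laplace_integrable => //; exact: Cplus_gt0. Qed.

Lemma Cintegrable_bounded f (c : R) : Cmeasurable [set` J] f ->
  (forall t, cmod (f t) <= c) -> Cintegrable [set` J] f.
Proof.
move=> mf fc; split=> //.
apply: (@measurable_bounded_integrable _ _ _ lam (fun t => cmod (f t))) => //.
  exact: measurable_cmod.
exists c; split; first exact: num_real.
by move=> x cx t _ /=; rewrite ger0_norm ?cmod_ge0// (le_trans (fc t))// ltW.
Qed.

(** If [fn] tends to [f] in [L^1(J)], the transforms converge at each point, so
    measurability and bounds on the energy pass to the limit. *)
Section convergence.
Variables (f : R -> R[i]) (fn : nat -> R -> R[i]) (c : R).
Hypothesis intf : Cintegrable [set` J] f.
Hypothesis intfn : forall n, Cintegrable [set` J] (fn n).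
Hypothesis close : forall n,
  (\int[lam]_(t in [set` J]) (cmod (f t - fn n t))%:E <= (c / 2 ^+ n)%:E)%E.

Lemma cmod_LapB_le n z : cmod (Lap f z - Lap (fn n) z) <= 2 * (c / 2 ^+ n).
Proof.
rewrite -lee_fin.
have -> : Lap f z - Lap (fn n) z = Lap (fun t => f t + (-1)%:C%C * fn n t) z.
  rewrite LapD ?LapZ//; last exact: CintegrableZ.
  by rewrite rmorphN1 mulN1r.
apply: le_trans (cmod_laplace_le J0 (Cplus_gt0 z) _) _.
  by apply: CintegrableD => //; exact: CintegrableZ.
rewrite EFinM lee_wpmul2l//; apply: le_trans (close n).
by under eq_integral do rewrite rmorphN1 mulN1r.
Qed.

Lemma Lap_cvg (h : R[i] -> R) z :
  (forall a b, `|h a - h b| <= cmod (a - b)) ->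
  h (Lap (fn n) z) @[n --> \oo] --> h (Lap f z).
Proof.
move=> hl; apply/cvgrPdist_le => e e0.
have : geometric (2 * c) 2^-1 n @[n --> \oo] --> 0.
  by apply: cvg_geometric; rewrite ger0_norm ?invr_ge0//; lra.
move/cvgrPdist_le => /(_ _ e0); apply: filterS => n.
rewrite sub0r normrN => geo; apply: le_trans (hl _ _) _.
apply: le_trans (cmod_LapB_le n z) _; apply: le_trans geo.
by rewrite /geometric /= exprVn mulrA ler_norm.
Qed.

Hypothesis measfn : forall n,
  Cmeasurable (setT : set (borel (Cplus R))) (Lap (fn n)).

Lemma Cmeasurable_Lap_lim :
  Cmeasurable (setT : set (borel (Cplus R))) (Lap f).
Proof.
apply/CmeasurableP => //; split.
- refine (@measurable_fun_cvg _ (borel (Cplus R)) R setT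
    (fun n z => complex.Re (Lap (fn n) z)) (fun z => complex.Re (Lap f z)) _ _).
    by move=> n; case/CmeasurableP : (measfn n).
  move=> z _; apply: (@Lap_cvg (@complex.Re R)) => a b.
  by rewrite -raddfB normr_Re_le_cmod.
- refine (@measurable_fun_cvg _ (borel (Cplus R)) R setT
    (fun n z => complex.Im (Lap (fn n) z)) (fun z => complex.Im (Lap f z)) _ _).
    by move=> n; case/CmeasurableP : (measfn n).
  move=> z _; apply: (@Lap_cvg (@complex.Im R)) => a b.
  by rewrite -raddfB normr_Im_le_cmod.
Qed.

Lemma energy_Lap_lim C : (forall n, (energy mu q (Lap (fn n)) <= C%:E)%E) ->
  (energy mu q (Lap f) <= C%:E)%E.
Proof.
apply: energy_fatou => // z; apply: Lap_cvg => a b.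
have := cmodD (a - b) b; rewrite subrK => h1.
have := cmodD (b - a) a; rewrite subrK -(cmodN (b - a)) opprB => h2.
by rewrite ler_norml; apply/andP; split; lra.
Qed.

End convergence.

(** Measurable functions bounded by 1 and vanishing off [E]. *)
Definition unit_on E f : Prop :=
  [/\ Cmeasurable setT f, forall t, cmod (f t) <= 1 & forall t, ~ E t -> f t = 0].

Lemma unit_on_measurable E f : unit_on E f -> Cmeasurable [set` J] f.
Proof. by case=> mf _ _; apply: measurable_funS mf. Qed.

Lemma unit_on_integrable E f : unit_on E f -> Cintegrable [set` J] f.
Proof.
move=> uf; apply: (@Cintegrable_bounded _ 1); first exact: unit_on_measurable uf.
by case: uf.
Qed.

Lemma unit_onS E E' f : E `<=` E' -> unit_on E f -> unit_on E' f.
Proof. by move=> EE' [mf f1 fE]; split=> // t E't; apply: fE => /EE'. Qed.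

Lemma unit_on_Linfty E f : unit_on E f ->
  Linfty J f /\ (Linfty_norm J f <= 1)%E.
Proof.
move=> uf; suff h : (Linfty_norm J f <= 1)%E.
  split=> //; split; first exact: unit_on_measurable uf.
  by apply: le_lt_trans h _; rewrite ltry.
rewrite /Linfty_norm unlock; case: ifPn => // _.
apply/ess_supP; apply: nearW => t /=.
by rewrite lee_fin ger0_norm ?cmod_ge0//; case: uf.
Qed.

(** Boundedness on [L^oo(J)], restated for functions bounded by 1. *)
Lemma unit_on_energy : exists2 K : R, 0 <= K & forall E f, unit_on E f ->
  Cmeasurable (setT : set (borel (Cplus R))) (Lap f) /\
  (energy mu q (Lap f) <= K%:E)%E.
Proof.
have [M HM] := bounded_Linfty.
(* The maximum covers a negative [M], possible when all norms vanish. *)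
exists ((Num.max M 0) `^ q); first exact: powR_ge0.
move=> E f uf; have [Lf Nf] := unit_on_Linfty uf.
have [_ [mLf _] +] := HM f Lf; rewrite /Lq_norm -/(Lap f) Lnorm_energy => bd.
split=> //.
have e0 := energy_ge0 mu q (Lap f).
have -> : energy mu q (Lap f) = ((energy mu q (Lap f) `^ q^-1) `^ q)%E.
  by rewrite -poweRrM mulVf ?gt_eqF// poweRe1.
rewrite -poweR_EFin; apply: gt0_ler_poweR.
- exact: ltW.
- by rewrite in_itv/= poweR_ge0 leey.
- by rewrite in_itv/= lee_fin le_max lexx orbT leey.
apply: le_trans bd _.
apply: (@le_trans _ _ ((Num.max M 0)%:E * Linfty_norm J f)%E).
  by rewrite lee_wpmul2r ?Lnorm_ge0// lee_fin le_max lexx.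
by rewrite -[leRHS]mule1 lee_wpmul2l// lee_fin le_max lexx orbT.
Qed.

(** The capacity of [E]: the largest energy of the transform of a function
    bounded by 1 and vanishing off [E]. *)
Definition capacity E : \bar R :=
  ereal_sup [set energy mu q (Lap f) | f in unit_on E].

Lemma energy_le_capacity E f : unit_on E f ->
  (energy mu q (Lap f) <= capacity E)%E.
Proof. by move=> uf; apply: ereal_sup_ubound; exists f. Qed.

Lemma unit_on0 E : unit_on E (fun=> 0).
Proof.
by split=> // [|t]; [exact: Cmeasurable_cst|rewrite cmod0].
Qed.

Lemma capacity_fin_num E : capacity E \is a fin_num.
Proof.
have [K K0 HK] := unit_on_energy.
rewrite ge0_fin_numE; last first.
  by apply: le_trans (energy_le_capacity (unit_on0 E)); exact: energy_ge0.
apply: (@le_lt_trans _ _ K%:E); last exact: ltry.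
by apply: ge_ereal_sup => _ [f uf <-]; have [] := HK _ _ uf.
Qed.

(** Apply Clarkson's inequality to [f + g] and [f - g], which are both bounded by
    1 and vanish off the union since the supports are disjoint. *)
Lemma capacity_superadditive A B f g : [disjoint A & B] ->
  unit_on A f -> unit_on B g ->
  (energy mu q (Lap f) + energy mu q (Lap g) <= capacity (A `|` B))%E.
Proof.
move=> AB uf ug.
have [K K0 HK] := unit_on_energy.
have intf := unit_on_integrable uf; have intg := unit_on_integrable ug.
have [mf _] := HK _ _ uf; have [mg _] := HK _ _ ug.
have comb (c : R) : `|c| = 1 -> unit_on (A `|` B) (fun t => f t + c%:C%C * g t).
  move=> c1; case: uf => [f1 f2 f3]; case: ug => [g1 g2 g3]; split.
  - apply: CmeasurableD => //; apply: CmeasurableM => //.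
    exact: Cmeasurable_cst.
  - move=> t; have [At|/f3 ->] := pselect (A t).
      have Bt : ~ B t by move=> Bt; move/disj_setPS : AB => /(_ t (conj At Bt)).
      by rewrite g3// mulr0 addr0.
    by rewrite add0r cmodM cmod_real c1 mul1r.
  - by move=> t /not_orP[/f3-> /g3->]; rewrite mulr0 addr0.
have Lapc (c : R) : Lap (fun t => f t + c%:C%C * g t) =
    (fun z => Lap f z + c%:C%C * Lap g z).
  by rewrite (LapD intf (CintegrableZ c mJ intg)) (LapZ c intg).
have capS : (energy mu q (fun z => Lap f z + Lap g z)%R <= capacity (A `|` B))%E.
  have := energy_le_capacity (comb 1 (normr1 _)); rewrite Lapc.
  by rewrite (_ : (fun z => _) = (fun z => Lap f z + Lap g z)%R)//;
    apply/funext => z; rewrite mul1r.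
have capB : (energy mu q (fun z => Lap f z - Lap g z)%R <= capacity (A `|` B))%E.
  have := energy_le_capacity (comb (-1) (normrN1 _)); rewrite Lapc.
  by rewrite (_ : (fun z => _) = (fun z => Lap f z - Lap g z)%R)//;
    apply/funext => z; rewrite rmorphN1 mulN1r.
have := le_trans (energy_clarkson mu q2 mf mg) (leeD capS capB).
move: (capacity_fin_num (A `|` B)).
move: (capacity _) (energy _ _ _ + energy _ _ _)%E => [k| |]// x _.
have -> : (k%:E + k%:E = 2%:E * k%:E)%E.
  by rewrite -EFinD -EFinM mulr_natl mulr2n.
by rewrite lee_pmul2l.
Qed.

Lemma le_capacity A B : A `<=` B -> (capacity A <= capacity B)%E.
Proof.
move=> AB; apply: ge_ereal_sup => _ [f uf <-].
by apply: energy_le_capacity; exact: unit_onS AB uf.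
Qed.

Lemma unit_on_patch E E' f : measurable E' -> unit_on E f ->
  unit_on (E `&` E') (patch (fun=> 0) E' f).
Proof.
move=> mE' [mf f1 fE]; split.
- by apply: Cmeasurable_patch => //; apply: measurable_funS mf.
- by move=> t; rewrite /patch; case: ifP => //; rewrite cmod0.
- move=> t EE't; rewrite /patch; case: ifPn => // /set_mem E't.
  by apply: fE => Et; apply: EE't.
Qed.

Lemma integral_cmod_unit_on_le E f : measurable E -> unit_on E f ->
  (\int[lam]_(t in [set` J]) (cmod (f t))%:E <= lam E)%E.
Proof.
move=> mE uf; have [_ f1 fE] := uf.
have -> : lam E = (\int[lam]_t (\1_E t)%:E)%E by rewrite integral_indic// setIT.
apply: (@le_trans _ _ (\int[lam]_(t in [set` J]) (\1_E t)%:E)%E).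
  apply: ge0_le_integral => //.
  - by move=> t _; rewrite lee_fin cmod_ge0.
  - apply/measurable_EFinP; apply: measurable_cmod.
    exact: unit_on_measurable uf.
  - by apply/measurable_EFinP; exact: measurable_indic.
  move=> t _; rewrite lee_fin indicE; have [_|/negP tE] := boolP (t \in E).
    exact: f1.
  by rewrite fE ?cmod0// => /mem_set.
apply: ge0_subset_integral => //.
by apply/measurable_EFinP; exact: measurable_indic.
Qed.

(** Gliding hump: suppose that sets of measures at most [2^-(n+1)] had capacities
    above [eps]. By superadditivity the part of their union [A] that lies outside
    a tail of the union has capacity at most [capacity A - eps]. These parts
    exhaust [A] up to a null set, and lower semicontinuity of the energy would
    give [capacity A <= capacity A - eps]. *)
Lemma capacity_small (eps : R) : 0 < eps -> exists2 delta : R, 0 < delta &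
  forall E, measurable E -> (lam E <= delta%:E)%E -> (capacity E <= eps%:E)%E.
Proof.
move=> eps0; apply: contrapT => hyp.
have bad n : exists E, [/\ measurable E, (lam E <= (1 / (2 ^ n.+1)%:R)%:E)%E &
    (eps%:E < capacity E)%E].
  apply: contrapT => hn; apply: hyp; exists (1 / (2 ^ n.+1)%:R).
    by rewrite divr_gt0// ltr0n expn_gt0.
  move=> E mE lE; rewrite leNgt; apply/negP => cE; apply: hn.
  by exists E.
have [E HE] := choice bad.
have mE n : measurable (E n) by have [] := HE n.
(* The tail unions: [A m] has measure at most [2^-m]. *)
pose A m := \bigcup_n E (m + n)%N.
have mA m : measurable (A m) by apply: bigcup_measurable => n _; exact: mE.
have AS m : A m `<=` A 0%N.
  by move=> t [n _ En]; exists (m + n)%N => //; rewrite add0n.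
have lA m : (lam (A m) <= (1 / 2 ^+ m)%:E)%E.
  apply: (@le_trans _ _ (\sum_(n <oo) lam (E (m + n)%N))%E).
    apply: measure_sigma_subadditive; [by move=> n; exact: mE|exact: mA|by []].
  apply: (@le_trans _ _ (\sum_(n <oo) ((1 / 2 ^+ m) / (2 ^ n.+1)%:R)%:E)%E).
    apply: lee_nneseries => // n _; have [_ + _] := HE (m + n)%N.
    move=> /le_trans; apply.
    by rewrite lee_fin -addnS expnD natrM natrX !div1r invfM.
  by apply: epsilon_trick0; rewrite divr_ge0// exprn_ge0.
have tail m g : unit_on (A 0%N `\` A m) g ->
    (energy mu q (Lap g) <= capacity (A 0%N) - eps%:E)%E.
  move=> ug.
  have : (eps%:E < capacity (A m))%E.
    have [_ _ +] := HE m => /lt_le_trans; apply; apply: le_capacity => t Et.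
    by exists 0%N => //; rewrite addn0.
  move=> /ereal_sup_gt[_ [h uh <-]] /ltW epsh.
  rewrite leeBrDr//; apply: le_trans (leeD2l _ epsh) _.
  apply: le_trans (capacity_superadditive _ ug uh) _.
    by apply/disj_setPS => t [[_ ?]].
  by apply: le_capacity => t [[]//|]; exact: AS.
have [a aE] : exists a : R, capacity (A 0%N) = a%:E.
  by exists (fine (capacity (A 0%N))); rewrite fineK// capacity_fin_num.
rewrite aE in tail.
suff : (capacity (A 0%N) <= (a - eps)%:E)%E.
  by rewrite aE lee_fin; lra.
apply: ge_ereal_sup => _ [f uf <-].
(* Removing the tail [A m] from [f] changes it in [L^1] by at most [2^-m]. *)
pose fn m := patch (fun=> 0) (~` A m) f.
have ufn m : unit_on (A 0%N `\` A m) (fn m).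
  by apply: unit_on_patch => //; exact: measurableC.
apply: (@energy_Lap_lim f fn 1).
- exact: unit_on_integrable uf.
- by move=> n; exact: unit_on_integrable (ufn n).
- move=> n.
  have un : unit_on (A n) (fun t => f t - fn n t).
    have -> : (fun t => f t - fn n t) = patch (fun=> 0) (A n) f.
      apply/funext => t; rewrite /fn /patch in_setC.
      by case: (t \in A n); rewrite ?subr0 ?subrr.
    exact: unit_onS (@subIsetr _ _ _) (unit_on_patch (mA n) uf).
  exact: le_trans (integral_cmod_unit_on_le (mA n) un) (lA n).
- have [K _ HK] := unit_on_energy.
  by move=> n; have [] := HK _ _ (ufn n).
- by move=> n; rewrite EFinB; exact: tail (ufn n).
Qed.

End absolute_continuity.

(** * N-functions of prescribed growth *)

Section primitive.
Context {R : realType}.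
Notation lam := (@lebesgue_measure R).
Variable phi : R -> R.
Hypothesis phi_ge0 : forall s, 0 <= phi s.
Hypothesis phi_homo : {homo phi : s t / s <= t}.

(** The primitive of [phi] on the half-line; it vanishes at negative arguments,
    so that it is monotone on the whole line. *)
Definition primitive (t : R) : R := \int[lam]_(s in `[0, t]) phi s.

Let mphi D : measurable D -> measurable_fun D (EFin \o phi).
Proof.
by move=> mD; apply/measurable_EFinP; exact: nondecreasing_measurable.
Qed.

Lemma integral_monotone_le (i : interval R) (c : R) : (lam [set` i] < +oo)%E ->
  (forall s, s \in i -> phi s <= c) ->
  (\int[lam]_(s in [set` i]) (phi s)%:E <= c%:E * lam [set` i])%E.
Proof.
move=> ifin ic; rewrite -integral_cst//; apply: ge0_le_integral => //.
- by move=> s _; rewrite lee_fin.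
- exact: mphi.
Qed.

Lemma integral_monotone_ge (i : interval R) (c : R) : 0 <= c ->
  (forall s, s \in i -> c <= phi s) ->
  (c%:E * lam [set` i] <= \int[lam]_(s in [set` i]) (phi s)%:E)%E.
Proof.
move=> c0 ic; rewrite -integral_cst//; apply: ge0_le_integral => //.
exact: mphi.
Qed.

Lemma primitiveE t :
  ((primitive t)%:E = \int[lam]_(s in `[0%R, t]) (phi s)%:E)%E.
Proof.
rewrite /primitive /Rintegral fineK// ge0_fin_numE; last first.
  by apply: integral_ge0 => s _; rewrite lee_fin.
have fin : (lam `[0%R, t]%classic < +oo)%E.
  by rewrite lebesgue_measure_itv; case: ifP => _; rewrite -?EFinD ltry.
apply: le_lt_trans (integral_monotone_le (c := phi t) fin _) _.
  by move=> s; rewrite in_itv => /andP[_]; exact: phi_homo.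
by rewrite -[lam _]fineK ?ge0_fin_numE// -EFinM ltry.
Qed.

Lemma primitive_le t : 0 <= t -> primitive t <= t * phi t.
Proof.
move=> t0; rewrite -lee_fin primitiveE.
have lt : lam `[0%R, t]%classic = t%:E.
  rewrite lebesgue_measure_itv /= lte_fin; case: ltP => [_|t0'].
    by rewrite -EFinD subr0.
  by congr EFin; lra.
apply: le_trans (integral_monotone_le (c := phi t) _ _) _.
- by rewrite lt ltry.
- by move=> s; rewrite in_itv => /andP[_]; exact: phi_homo.
- by rewrite lt -EFinM lee_fin mulrC.
Qed.

Lemma primitive_step s t : 0 <= s -> s <= t ->
  primitive s + (t - s) * phi s <= primitive t.
Proof.
move=> s0 st; rewrite -lee_fin EFinD !primitiveE.
have -> : `[0%R, t]%classic = `[0%R, s]%classic `|` `]s, t]%classic :> set R.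
  by rewrite -itv_bndbnd_setU// bnd_simp.
rewrite ge0_integral_setU//; last 3 first.
- by apply: mphi; exact: measurableU.
- by move=> u _; rewrite lee_fin.
- apply/disj_setPS => u [/=]; rewrite !in_itv/= => /andP[_ us] /andP[su _].
  by move: (lt_le_trans su us); rewrite ltxx.
apply: leeD => //.
apply: le_trans (integral_monotone_ge (c := phi s) _ _) => //.
  rewrite lebesgue_measure_itv /= lte_fin; case: ltP => [_|ts].
    by rewrite -EFinD -EFinM lee_fin mulrC.
  by rewrite mule0 lee_fin (_ : t - s = 0) ?mul0r//; lra.
by move=> u; rewrite in_itv/= => /andP[/ltW + _]; exact: phi_homo.
Qed.

Lemma primitive_lt0 t : t < 0 -> primitive t = 0.
Proof.
move=> t0; rewrite /primitive set_itv_ge ?Rintegral_set0//.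
by rewrite bnd_simp -ltNge.
Qed.

Lemma primitive_ge0 t : 0 <= primitive t.
Proof. exact: Rintegral_ge0. Qed.

Lemma primitive_homo : {homo primitive : s t / s <= t}.
Proof.
move=> s t st; have [s0|s0] := ltP s 0.
  by rewrite (primitive_lt0 s0) primitive_ge0.
apply: le_trans (primitive_step s0 st).
by rewrite lerDl mulr_ge0// subr_ge0.
Qed.

Lemma primitive_half t : 0 <= t -> 2 * primitive (t / 2) <= primitive t.
Proof.
move=> t0; have h0 : 0 <= t / 2 by rewrite divr_ge0.
have h1 := primitive_step h0 (ltac:(lra) : t / 2 <= t).
have h2 := primitive_le h0.
have e : t - t / 2 = t / 2 by lra.
rewrite e in h1; lra.
Qed.

Lemma primitive_ge t : 0 <= t -> t / 2 * phi (t / 2) <= primitive t.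
Proof.
move=> t0; have h0 : 0 <= t / 2 by rewrite divr_ge0.
have h1 := primitive_step h0 (ltac:(lra) : t / 2 <= t).
have e : t - t / 2 = t / 2 by lra.
rewrite e in h1; have := primitive_ge0 (t / 2); lra.
Qed.

End primitive.

Section fast_N_function.
Context {R : realType}.
Variable c : nat -> R.

(** Step weights, nondecreasing and at least 1, that dominate the prescribed
    sequence [c]. *)
Definition weight (n : nat) : R := 1 + \sum_(i < n.+1) 4 * `|c i|.

Lemma weight_homo : {homo weight : m n / (m <= n)%N >-> m <= n}.
Proof.
apply: homo_leq => [//|n m p|n]; first exact: le_trans.
by rewrite /weight lerD2l [leRHS]big_ord_recr/= lerDl mulr_ge0.
Qed.

Lemma weight_ge1 n : 1 <= weight n.
Proof. by rewrite /weight lerDl sumr_ge0// => i _; rewrite mulr_ge0. Qed.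

Lemma weight_ge n : 4 * c n <= weight n.
Proof.
rewrite /weight big_ord_recr/= addrCA.
have : 0 <= \sum_(i < n) 4 * `|c i|.
  by rewrite sumr_ge0// => i _; rewrite mulr_ge0.
have := ler_norm (c n); lra.
Qed.

(** A left-continuous density: the identity times a step function of the ceiling.
    Truncating at 0 makes it monotone on the whole line. *)
Definition density (s : R) : R :=
  Num.max s 0 * weight (absz (Num.ceil (Num.max s 0))).

Lemma density_ge0 s : 0 <= density s.
Proof.
by rewrite mulr_ge0 ?le_max ?lexx ?orbT// (le_trans _ (weight_ge1 _)).
Qed.

Lemma densityE s : 0 <= s -> density s = s * weight (absz (Num.ceil s)).
Proof. by move=> s0; rewrite /density max_l. Qed.

Lemma density_homo : {homo density : s t / s <= t}.
Proof.
move=> s t st; rewrite /density.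
have st' : Num.max s 0 <= Num.max t 0 by rewrite ge_max !le_max st lexx !orbT.
have s0 : 0 <= Num.max s 0 by rewrite le_max lexx orbT.
apply: ler_pM => //; first exact: le_trans (weight_ge1 _).
apply: weight_homo; rewrite -lez_nat !gez0_abs ?le_ceil// ceil_ge0.
  exact: lt_le_trans (le_trans s0 st').
exact: lt_le_trans s0.
Qed.

Lemma density_ge s : 0 <= s -> s <= density s.
Proof. by move=> s0; rewrite densityE// ler_peMr// weight_ge1. Qed.

Lemma density_left_continuous s : 0 < s ->
  density x @[x --> s^'-] --> density s.
Proof.
move=> s0.
have h : \forall x \near s^'-, x * weight (absz (Num.ceil s)) = density x.
  near=> x.
  have xs : x < s by near: x; exact: nbhs_left_lt.
  have x0 : 0 < x by near: x; exact: nbhs_left_gt.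
  have cx : (Num.ceil s - 1)%:~R < x.
    by near: x; exact: nbhs_left_gt (ceilB1_lt s).
  have -> : Num.ceil s = Num.ceil x.
    apply/esym/ceil_def; rewrite cx/=.
    by apply: le_trans (ltW xs) _; exact: ceil_ge.
  by rewrite densityE// ltW.
apply: cvg_trans (near_eq_cvg h) _.
rewrite densityE ?ltW//; apply: cvgMl.
apply: cvg_at_left_filter; exact: cvg_id.
Unshelve. all: by end_near. Qed.

(** N-functions can grow arbitrarily fast along the powers of 2. *)
Lemma fast_N_function : exists Phi : R -> R,
  [/\ N_function Phi, {homo Phi : s t / s <= t},
      forall t, 0 <= t -> 2 * Phi (t / 2) <= Phi t,
      forall t, 0 <= t -> t ^+ 2 / 4 <= Phi t &
      forall n, c n <= Phi (2 ^+ n)].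
Proof.
have ge := primitive_ge density_ge0 density_homo.
have quad t : 0 <= t -> t ^+ 2 / 4 <= primitive density t.
  move=> t0; apply: le_trans (ge t t0).
  have h0 : 0 <= t / 2 by rewrite divr_ge0.
  have := ler_wpM2l h0 (density_ge h0); lra.
exists (primitive density); split; last first.
(* With [h = 2 ^+ n / 2], the bound is [h * (h * weight)], where [h >= 1 / 2] and
   [weight >= 4 * c n] because the ceiling of [h] is at least [n]. *)
- move=> n; apply: le_trans (ge _ _); last exact: exprn_ge0.
  set h := 2 ^+ n / 2; have h1 : 2^-1 <= h.
    by rewrite /h -[leLHS]mul1r ler_wpM2r ?invr_ge0// exprn_ege1// ler1n.
  have h0 : 0 <= h by lra.
  have nh : (n <= absz (Num.ceil h))%N.
    rewrite /h; case: n @h h1 h0 => [//|n] h _ h0.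
    have -> : 2 ^+ n.+1 / 2 = (2 ^ n)%:R :> R.
      by rewrite exprSr mulfK ?pnatr_eq0// natrX.
    rewrite -[X in Num.ceil X]mulrz_nat intrKceil ?natz.
    exact: ltn_expl.
  rewrite densityE//.
  have w1 := le_trans (weight_ge n) (weight_homo nh).
  have w0 := weight_ge1 (absz (Num.ceil h)).
  set w := weight _ in w1 w0 *.
  have hh : 2^-1 * 2^-1 <= h * h by rewrite ler_pM ?invr_ge0.
  have w0' : 0 <= w by lra.
  have := ler_wpM2r w0' hh; rewrite -mulrA; lra.
- exact: quad.
- move=> t t0; apply: primitive_half => //; first exact: density_ge0.
  exact: density_homo.
- by apply: primitive_homo; [exact: density_ge0|exact: density_homo].
split.
- exists (EFin \o density).
    split.
    + by move=> s _; rewrite lee_fin density_ge0.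
    + by move=> s t _ st; rewrite lee_fin density_homo.
    + move=> s s0; apply: cvg_EFin; first exact: nearW.
      exact: density_left_continuous.
    + move=> /(_ 1 ler01)/eqP; rewrite eqe; apply/negP.
      by rewrite gt_eqF// (lt_le_trans ltr01)// density_ge.
    + by move=> /(_ 0 (lexx _)).
  move=> t t0; rewrite /= primitiveE//; first exact: density_ge0.
  exact: density_homo.
- apply: (@squeeze_cvgr _ _ _ _ (fun=> 0) (fun x => x * weight 1)).
  + near=> x.
    have x0 : 0 < x by near: x; exact: nbhs_right_gt.
    have x1 : x <= 1 by near: x; exact: nbhs_right_le.
    rewrite divr_ge0 ?(ltW x0) ?primitive_ge0 ?density_ge0//=; last first.
      exact: density_ge0.
    rewrite ler_pdivrMr// mulrC; apply: le_trans (primitive_le _ _ (ltW x0)) _.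
    * exact: density_ge0.
    * exact: density_homo.
    rewrite (densityE (ltW x0)) !(ler_wpM2l (ltW x0))//.
    apply: weight_homo; rewrite -lez_nat gez0_abs ?ceil_ge0 ?ceil_le_int//.
    by rewrite (lt_trans _ x0)// ltrN10.
  + exact: cvg_cst.
  + rewrite -[X in _ --> X](mul0r (weight 1)); apply: cvgMl.
    by apply: cvg_at_right_filter; exact: cvg_id.
- apply: (@squeeze_cvgr _ _ _ _ (fun=> 0) (fun x => 4 * x^-1)).
  + near=> x.
    have x0 : 0 < x by near: x; exact: nbhs_pinfty_gt.
    have := quad x (ltW x0) => Qx.
    have x2 : 0 < x ^+ 2 / 4 by rewrite divr_gt0 ?exprn_gt0.
    have P0 := lt_le_trans x2 Qx.
    rewrite divr_ge0 ?(ltW x0) ?(ltW P0)//= ler_pdivrMr//.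
    have e : 4 * x^-1 * (x ^+ 2 / 4) = x by field; exact: lt0r_neq0.
    by rewrite -[leLHS]e ler_wpM2l// mulr_ge0 ?invr_ge0 ?(ltW x0).
  + exact: cvg_cst.
  + rewrite -[X in _ --> X](mulr0 4); apply: cvgMr.
    apply/(gtr0_cvgV0 (f := id)); last exact: cvg_id.
    by near=> x; near: x; exact: nbhs_pinfty_gt.
Unshelve. all: by end_near. Qed.

End fast_N_function.

(** * The unit ball of the Orlicz space *)

Section unit_ball.
Context {R : realType}.
Notation lam := (@lebesgue_measure R).
Variables (q : R) (J : interval R).
Variable mu : {measure set (borel (Cplus R)) -> \bar R}.
Hypothesis q2 : 2 <= q.
Hypothesis J0 : [set` J] `<=` `]0, +oo[.
Hypothesis Jfin : (lam [set` J] < +oo)%E.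

(** [K] bounds the energy of the transforms of functions bounded by 1, and [C]
    that of twice such functions; [delta j] is the measure below which a set has
    capacity small enough for the dyadic level [j]. *)
Variables (K C : R) (delta : nat -> R) (Phi : R -> R).
Hypothesis K_bound : forall E f, unit_on E f ->
  Cmeasurable (setT : set (borel (Cplus R))) (Lap J f) /\
  (energy mu q (Lap J f) <= K%:E)%E.
Hypothesis C_gt0 : 0 < C.
Hypothesis KC : 2 `^ q * K <= C.
Hypothesis delta_gt0 : forall j, 0 < delta j.
Hypothesis delta_small : forall j E, measurable E ->
  (lam E <= (delta j)%:E)%E ->
  (capacity q J mu E <= (C / (2 ^+ (2 * j + 3)) `^ q)%:E)%E.
Hypothesis Phi_homo : {homo Phi : s t / s <= t}.
Hypothesis Phi_quad : forall t, 0 <= t -> t ^+ 2 / 4 <= Phi t.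
Hypothesis Phi_fast : forall j, (delta j)^-1 <= Phi (2 ^+ j).

Variable f : R -> R[i].
Hypothesis mf : Cmeasurable [set` J] f.
Hypothesis Phif : (\int[lam]_(t in [set` J]) (Phi (cmod (f t)))%:E <= 1)%E.

Let mJ : measurable [set` J]. Proof. exact: measurable_itv. Qed.

Let Phi_ge0 t : 0 <= t -> 0 <= Phi t.
Proof.
by move=> t0; apply: le_trans (Phi_quad t0); rewrite divr_ge0// exprn_ge0.
Qed.

Let mPhif : measurable_fun [set` J] (fun t => (Phi (cmod (f t)))%:E).
Proof.
apply/measurable_EFinP; apply: (@measurableT_comp _ _ _ _ _ _ Phi).
  exact: nondecreasing_measurable.
exact: measurable_cmod.
Qed.

Lemma orlicz_integrable : Cintegrable [set` J] f.
Proof.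
split=> //; pose h t := (1%:E + 4%:E * (Phi (cmod (f t)))%:E)%E.
apply: (@le_integrable _ _ _ lam [set` J] mJ _ h).
- by apply/measurable_EFinP; exact: measurable_cmod.
- move=> t _; have c0 := cmod_ge0 (f t); have := Phi_quad c0 => Qt.
  rewrite /h -EFinM -EFinD lee_fin (ger0_norm c0) ger0_norm; last first.
    by have := Phi_ge0 c0; lra.
  have := sqr_ge0 (cmod (f t) - 1); rewrite sqrrB1; lra.
- apply: integrableD => //.
    apply/integrableP; split; first exact: measurable_cst.
    by rewrite /= normr1 integral_cst// mul1e.
  apply: integrableZl => //; apply/integrableP; split=> //.
  apply: le_lt_trans (ltry 1); apply: le_trans Phif.
  under eq_integral => t _ do rewrite gee0_abs ?lee_fin ?Phi_ge0 ?cmod_ge0//.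
  by [].
Qed.

(** The part of [J] where [a <= |f| < b]. *)
Definition level (a b : R) : set R :=
  [set` J] `&` [set t | a <= cmod (f t) < b].

(** The function [f] on [level a b], and 0 elsewhere. *)
Definition cut a b : R -> R[i] := patch (fun=> 0) (level a b) f.

Lemma in_level a b t :
  (t \in level a b) = (t \in [set` J]) && (a <= cmod (f t) < b).
Proof.
by rewrite /level in_setI; congr (_ && _); apply/idP/idP => [/set_mem|/mem_set].
Qed.

Lemma measurable_level a b : measurable (level a b).
Proof.
have -> : level a b = [set` J] `&` (fun t => cmod (f t)) @^-1` `[a, b[.
  by apply/seteqP; split=> t [? ?]; split; rewrite //= in_itv.
by apply: measurable_cmod => //; exact: measurable_itv.
Qed.

Lemma Cmeasurable_cut a b : Cmeasurable setT (cut a b).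
Proof.
apply: Cmeasurable_patch => //; first exact: measurable_level.
by apply: measurable_funS mf => // t [_ []].
Qed.

Lemma cmod_cut_le a b t : 0 <= b -> cmod (cut a b t) <= b.
Proof.
move=> b0; rewrite /cut /patch; case: ifPn => [/set_mem[_ /= /andP[_ /ltW]]//|_].
by rewrite cmod0.
Qed.

Lemma Cintegrable_cut a b : 0 <= b -> Cintegrable [set` J] (cut a b).
Proof.
move=> b0; apply: (@Cintegrable_bounded _ _ Jfin _ b).
  by apply: measurable_funS (Cmeasurable_cut a b).
by move=> t; exact: cmod_cut_le.
Qed.

Lemma unit_on_cut a b : 0 < b ->
  unit_on (level a b) (fun t => (b^-1)%:C%C * cut a b t).
Proof.
move=> b0; split.
- apply: CmeasurableM => //; [exact: Cmeasurable_cst|exact: Cmeasurable_cut].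
- move=> t; rewrite cmodM cmod_real ger0_norm ?invr_ge0 ?(ltW b0)//.
  by rewrite ler_pdivrMl// mulr1 cmod_cut_le// (ltW b0).
- by move=> t nt; rewrite /cut /patch memNset ?mulr0.
Qed.

Lemma Lap_cutE a b : 0 < b ->
  Lap J (cut a b) =
  (fun z => b%:C%C * Lap J (fun t => (b^-1)%:C%C * cut a b t) z).
Proof.
move=> b0; rewrite (LapZ J0 _ (Cintegrable_cut _ (ltW b0))); apply/funext => z.
by rewrite mulrA -rmorphM divff ?gt_eqF// mul1r.
Qed.

Lemma Cmeasurable_Lap_cut a b : 0 < b ->
  Cmeasurable (setT : set (borel (Cplus R))) (Lap J (cut a b)).
Proof.
move=> b0; rewrite Lap_cutE//; apply: CmeasurableM => //.
  exact: Cmeasurable_cst.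
by have [] := K_bound (unit_on_cut a b0).
Qed.

Lemma energy_cut_le a b (s : R) : 0 < b -> 0 <= s ->
  (energy mu q (fun z => s%:C%C * Lap J (cut a b) z)%R <=
   ((s * b) `^ q)%:E * capacity q J mu (level a b))%E.
Proof.
move=> b0 s0; have uc := unit_on_cut a b0.
have [mu' _] := K_bound uc.
rewrite Lap_cutE//.
rewrite (_ : (fun z => _) = (fun z => (s * b)%:C%C *
    Lap J (fun t => (b^-1)%:C%C * cut a b t) z)%R); last first.
  by apply/funext => z; rewrite mulrA -rmorphM.
rewrite energyZ// ger0_norm ?mulr_ge0 ?(ltW b0)//.
rewrite lee_wpmul2l ?lee_fin ?powR_ge0//.
exact: energy_le_capacity.
Qed.

(** Markov's inequality for the dyadic level sets. *)
Lemma level_small j : (lam (level (2 ^+ j) (2 ^+ j.+1)) <= (delta j)%:E)%E.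
Proof.
set S := level _ _; have mS : measurable S by exact: measurable_level.
have P0 : 0 < Phi (2 ^+ j).
  by apply: lt_le_trans (Phi_fast j); rewrite invr_gt0.
suff : ((Phi (2 ^+ j))%:E * lam S <= 1)%E.
  move=> h; have : (lam S <= ((Phi (2 ^+ j))^-1)%:E)%E.
    by rewrite -[leRHS]mule1 lee_pdivlMl.
  move=> /le_trans; apply; rewrite lee_fin -[leRHS]invrK.
  by rewrite lef_pV2 ?posrE ?invr_gt0.
apply: le_trans Phif; rewrite -integral_cst//.
apply: (@le_trans _ _ (\int[lam]_(t in S) (Phi (cmod (f t)))%:E)%E).
  apply: ge0_le_integral => //.
  - by move=> t _; rewrite lee_fin ltW.
  - by apply: measurable_funS mPhif => // t [].
  - by move=> t [_ /andP[jt _]]; rewrite lee_fin Phi_homo.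
apply: ge0_subset_integral => // [t _|t []//].
by rewrite lee_fin Phi_ge0// cmod_ge0.
Qed.

Lemma energy_dyadic_cut j :
  (energy mu q (fun z => (2 ^+ j.+2)%:C%C * Lap J (cut (2 ^+ j) (2 ^+ j.+1)) z)%R
   <= C%:E)%E.
Proof.
apply: le_trans (energy_cut_le _ _ _) _; rewrite ?exprn_gt0 ?exprn_ge0//.
have := delta_small (measurable_level (2 ^+ j) (2 ^+ j.+1)) (level_small j).
have -> : 2 ^+ j.+2 * 2 ^+ j.+1 = 2 ^+ (2 * j + 3) :> R.
  by rewrite -exprD !addSn addnS addn3 mul2n addnn.
set s := _ `^ _ => h; have s0 : 0 < s by rewrite powR_gt0 ?exprn_gt0.
apply: (@le_trans _ _ (s%:E * (C / s)%:E)%E).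
  by rewrite lee_wpmul2l// lee_fin ltW.
by rewrite -EFinM lee_fin mulrC divfK ?gt_eqF.
Qed.

Lemma cutD a b c : a <= b -> b <= c ->
  cut a c = (fun t => cut a b t + cut b c t).
Proof.
move=> ab bc; apply/funext => t; rewrite /cut /patch !in_level.
case: (t \in [set` J]); rewrite /= ?addr0//.
have [mb|bm] := ltP (cmod (f t)) b.
  by rewrite (lt_le_trans mb bc) !andbT addr0.
by rewrite (le_trans ab bm) andbF add0r.
Qed.

Lemma Lap_cutD a b c : 0 <= a -> a <= b -> b <= c ->
  Lap J (cut a c) = (fun z => Lap J (cut a b) z + Lap J (cut b c) z).
Proof.
move=> a0 ab bc; rewrite (cutD ab bc).
rewrite (LapD J0 (Cintegrable_cut _ _) (Cintegrable_cut _ _))//.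
- exact: le_trans ab.
- exact: le_trans (le_trans a0 ab) bc.
Qed.

(** By induction on [n]: the function bounded here is the midpoint of [2^(j+2)]
    times the piece of [f] where [2^j <= |f| < 2^(j+1)] and of the corresponding
    function for [j + 1] and [n - 1]. *)
Lemma energy_cut_pow n j :
  (energy mu q (fun z => (2 ^+ j.+1)%:C%C * Lap J (cut (2 ^+ j) (2 ^+ (j + n))) z)%R
   <= C%:E)%E.
Proof.
elim: n j => [|n IHn] j.
  have -> : cut (2 ^+ j) (2 ^+ (j + 0)) = (fun t => 0%:C%C * cut 0 1 t).
    apply/funext => t; rewrite mul0r addn0 /cut /patch in_level.
    by case: ifP => // /and3P[_ h1 h2]; move: (le_lt_trans h1 h2); rewrite ltxx.
  rewrite (LapZ J0 _ (Cintegrable_cut _ ler01)) /energy.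
  under eq_integral do rewrite mul0r mulr0 cmod0 powR0 ?gt_eqF ?(lt_le_trans _ q2)//.
  by rewrite integral0 lee_fin ltW.
have p0 i : 0 < 2 ^+ i :> R by rewrite exprn_gt0.
have pS i m : 2 ^+ i <= 2 ^+ (i + m) :> R by rewrite ler_eXn2l ?ltr1n// leq_addr.
have h1 : 2 ^+ j <= 2 ^+ j.+1 :> R by have := pS j 1%N; rewrite addn1.
have h2 : 2 ^+ j.+1 <= 2 ^+ (j + n.+1) :> R by rewrite -addSnnS; exact: pS.
rewrite (Lap_cutD (ltW (p0 j)) h1 h2).
rewrite (_ : (fun z => _) = (fun z => (2^-1)%:C%C *
   ((2 ^+ j.+2)%:C%C * Lap J (cut (2 ^+ j) (2 ^+ j.+1)) z +
    (2 ^+ j.+2)%:C%C * Lap J (cut (2 ^+ j.+1) (2 ^+ (j.+1 + n))) z))%R); last first.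
  apply/funext => z; rewrite -mulrDr mulrA -rmorphM; congr (_%:C%C * _).
  by rewrite [2 ^+ j.+2]exprS mulKf ?pnatr_eq0.
  by rewrite addSnnS.
apply: energy_midpoint_le => //.
- by apply: le_trans q2; rewrite ler1n.
- apply: CmeasurableM => //; first exact: Cmeasurable_cst.
  exact: Cmeasurable_Lap_cut.
- apply: CmeasurableM => //; first exact: Cmeasurable_cst.
  exact: Cmeasurable_Lap_cut.
- exact: energy_dyadic_cut.
Qed.

Lemma energy_truncation n : (energy mu q (Lap J (cut 0 (2 ^+ n))) <= C%:E)%E.
Proof.
have n1 : 1 <= 2 ^+ n :> R by rewrite exprn_ege1// ler1n.
rewrite (Lap_cutD (lexx 0) ler01 n1).
rewrite (_ : (fun z => _) = (fun z => (2^-1)%:C%C *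
   (2%:C%C * Lap J (cut 0 1) z +
    2%:C%C * Lap J (cut 1 (2 ^+ n)) z))%R); last first.
  apply/funext => z; rewrite -mulrDr mulrA -rmorphM mulVf ?pnatr_eq0//.
  by rewrite mul1r.
have n0 : 0 < 2 ^+ n :> R by rewrite exprn_gt0.
apply: energy_midpoint_le => //.
- by apply: le_trans q2; rewrite ler1n.
- apply: CmeasurableM => //; first exact: Cmeasurable_cst.
  exact: Cmeasurable_Lap_cut.
- apply: CmeasurableM => //; first exact: Cmeasurable_cst.
  exact: Cmeasurable_Lap_cut.
- apply: le_trans (energy_cut_le _ _ _) _ => //; rewrite mulr1.
  apply: (@le_trans _ _ ((2 `^ q)%:E * K%:E)%E); last by rewrite -EFinM lee_fin.
  rewrite lee_wpmul2l ?lee_fin ?powR_ge0//.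
  by apply: ge_ereal_sup => _ [g ug <-]; have [] := K_bound ug.
- by have := energy_cut_pow n 0; rewrite expr1 expr0 add0n.
Qed.

(** Where [|f| >= 2^n], one has [|f| <= |f|^2 / 2^n <= 4 * Phi |f| / 2^n]. *)
Lemma truncation_close n :
  (\int[lam]_(t in [set` J]) (cmod (f t - cut 0 (2 ^+ n) t))%:E <=
   (4 / 2 ^+ n)%:E)%E.
Proof.
have n0 : 0 < 2 ^+ n :> R by rewrite exprn_gt0.
have h0 : 0 <= 4 / 2 ^+ n :> R by rewrite divr_ge0// ltW.
have mfc : measurable_fun [set` J] (fun t => (cmod (f t - cut 0 (2 ^+ n) t))%:E).
  apply/measurable_EFinP/measurable_cmod/CmeasurableB => //.
  by apply: measurable_funS (Cmeasurable_cut 0 (2 ^+ n)).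
apply: (@le_trans _ _ (\int[lam]_(t in [set` J])
    ((4 / 2 ^+ n)%:E * (Phi (cmod (f t)))%:E))%E).
  apply: ge0_le_integral => //.
  - by move=> t _; rewrite lee_fin cmod_ge0.
  - exact: measurable_funeM.
  move=> t Jt; rewrite -EFinM lee_fin /cut /patch; case: ifPn => [_|/negP tl].
    by rewrite subrr cmod0 mulr_ge0// Phi_ge0// cmod_ge0.
  have c0 := cmod_ge0 (f t).
  have big : 2 ^+ n <= cmod (f t).
    rewrite leNgt; apply/negP => lt; apply: tl; apply/mem_set; split=> //=.
    by rewrite c0.
  rewrite subr0 mulrAC ler_pdivlMr//.
  apply: (@le_trans _ _ (cmod (f t) ^+ 2)).
    by rewrite expr2 ler_wpM2l.
  by have := Phi_quad c0; lra.
rewrite ge0_integralZl//; last first.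
  by move=> t _; rewrite lee_fin Phi_ge0// cmod_ge0.
by rewrite -[leRHS]mule1 lee_wpmul2l// lee_fin.
Qed.

Lemma energy_unit_ball :
  Cmeasurable (setT : set (borel (Cplus R))) (Lap J f) /\
  (energy mu q (Lap J f) <= C%:E)%E.
Proof.
have intc n : Cintegrable [set` J] (cut 0 (2 ^+ n)).
  by apply: Cintegrable_cut; exact: exprn_ge0.
have mc n : Cmeasurable (setT : set (borel (Cplus R))) (Lap J (cut 0 (2 ^+ n))).
  by apply: Cmeasurable_Lap_cut; exact: exprn_gt0.
split.
  exact: Cmeasurable_Lap_lim orlicz_integrable intc truncation_close mc.
exact: energy_Lap_lim orlicz_integrable intc truncation_close mc _ energy_truncation.
Qed.

End unit_ball.

(** * Boundedness for the Luxemburg norm *)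

Section from_unit_ball.
Context {R : realType}.
Notation lam := (@lebesgue_measure R).
Variables (q : R) (J : interval R).
Variable mu : {measure set (borel (Cplus R)) -> \bar R}.
Hypothesis q0 : 0 < q.
Hypothesis J0 : [set` J] `<=` `]0, +oo[.
Variables (C : R) (Phi : R -> R).
Hypothesis C_gt0 : 0 < C.
Hypothesis Phi_ge0 : forall t, 0 <= t -> 0 <= Phi t.
Hypothesis Phi_homo : {homo Phi : s t / s <= t}.
Hypothesis Phi_half : forall t, 0 <= t -> 2 * Phi (t / 2) <= Phi t.
Hypothesis ball : forall f, Cmeasurable [set` J] f ->
  (\int[lam]_(t in [set` J]) (Phi (cmod (f t)))%:E <= 1)%E ->
  [/\ Cintegrable [set` J] f,
      Cmeasurable (setT : set (borel (Cplus R))) (Lap J f) &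
      (energy mu q (Lap J f) <= C%:E)%E].

Let mJ : measurable [set` J]. Proof. exact: measurable_itv. Qed.

Lemma Phi_dyadic n t : 0 <= t -> 2 ^+ n * Phi (t / 2 ^+ n) <= Phi t.
Proof.
move=> t0; elim: n => [|n IHn]; first by rewrite expr0 mul1r divr1.
apply: le_trans IHn.
have -> : t / 2 ^+ n.+1 = t / 2 ^+ n / 2 by rewrite exprSr invfM mulrA.
by rewrite exprSr -mulrA ler_wpM2l ?exprn_ge0// Phi_half// divr_ge0// exprn_ge0.
Qed.

(** Enlarging the scale by [2^n] divides the integral of [Phi] by at least [2^n]. *)
Lemma orlicz_unit_scale f : orlicz (EFin \o Phi) J f -> exists2 k : R, 0 < k &
  (\int[lam]_(t in [set` J]) (Phi (k^-1 * cmod (f t)))%:E <= 1)%E.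
Proof.
move=> [mf [k k0 intk]].
have /(_ mJ)/= /fineK := integrable_fin_num _ intk.
set A := fine _ => AE.
have [n An] : exists n, A <= 2 ^+ n.
  exists (Num.bound `|A|); apply: le_trans (ler_norm A) _.
  apply: le_trans (ltW (archi_boundP (normr_ge0 A))) _.
  by rewrite -natrX ler_nat ltnW// ltn_expl.
have n0 : 0 < 2 ^+ n :> R by rewrite exprn_gt0.
exists (k * 2 ^+ n); first exact: mulr_gt0.
have mP (c : R) : measurable_fun [set` J] (fun t => (Phi (c * cmod (f t)))%:E).
  apply/measurable_EFinP; apply: (@measurableT_comp _ _ _ _ _ _ Phi).
    exact: nondecreasing_measurable.
  apply: measurable_funM; first exact: measurable_cst.
  exact: measurable_cmod.
have c0 (c : R) t : 0 < c -> 0 <= c^-1 * cmod (f t).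
  by move=> c0; rewrite mulr_ge0 ?invr_ge0 ?cmod_ge0// ltW.
rewrite -(lee_pmul2l (_ : (2 ^+ n)%:E \is a fin_num)) ?lte_fin// mule1.
rewrite -ge0_integralZl//; last 2 first.
- exact: mP.
- by move=> t _; rewrite lee_fin Phi_ge0// c0// mulr_gt0.
apply: (@le_trans _ _ A%:E); last by rewrite lee_fin.
rewrite AE; apply: ge0_le_integral => //.
- move=> t _; rewrite -EFinM lee_fin mulr_ge0 ?(ltW n0)//.
  by rewrite Phi_ge0// c0// mulr_gt0.
- by apply: measurable_funeM; exact: mP.
- exact: mP.
move=> t _; rewrite -EFinM lee_fin.
apply: le_trans (Phi_dyadic n (c0 k t k0)).
by rewrite invfM mulrAC.
Qed.

Lemma orlicz_scaled f (k : R) : 0 < k -> Cmeasurable [set` J] f ->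
  (\int[lam]_(t in [set` J]) (Phi (k^-1 * cmod (f t)))%:E <= 1)%E ->
  [/\ Cintegrable [set` J] f,
      Cmeasurable (setT : set (borel (Cplus R))) (Lap J f) &
      (Lq_norm mu q (Lap J f) <= (C `^ q^-1 * k)%:E)%E].
Proof.
move=> k0 mf int1; pose g t := (k^-1)%:C%C * f t.
have mg : Cmeasurable [set` J] g.
  by apply: CmeasurableM => //; exact: Cmeasurable_cst.
have gE t : cmod (g t) = k^-1 * cmod (f t).
  by rewrite cmodM cmod_real ger0_norm// invr_ge0 ltW.
have [|ig mLg eg] := ball mg; first by under eq_integral do rewrite gE.
have fE : f = (fun t => k%:C%C * g t).
  by apply/funext => t; rewrite /g mulrA -rmorphM divff ?gt_eqF// mul1r.
have LE : Lap J f = (fun z => k%:C%C * Lap J g z) by rewrite {1}fE (LapZ J0 k ig).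
split.
- by rewrite fE; exact: CintegrableZ.
- by rewrite LE; apply: CmeasurableM => //; exact: Cmeasurable_cst.
rewrite /Lq_norm Lnorm_energy LE energyZ// ger0_norm ?(ltW k0)//.
apply: (@le_trans _ _ (((k `^ q)%:E * C%:E) `^ q^-1)%E).
  apply: gt0_ler_poweR.
  - by rewrite invr_ge0 ltW.
  - by rewrite in_itv/= leey andbT mule_ge0 ?energy_ge0 ?lee_fin ?powR_ge0.
  - by rewrite in_itv/= leey andbT -EFinM lee_fin mulr_ge0 ?powR_ge0// ltW.
  - by rewrite lee_wpmul2l ?lee_fin ?powR_ge0.
rewrite -EFinM poweR_EFin lee_fin powRM ?powR_ge0 ?(ltW C_gt0)//.
by rewrite -powRrM divff ?gt_eqF// powRr1 ?(ltW k0)// mulrC.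
Qed.

Lemma laplace_bounded_orlicz :
  laplace_bounded J (orlicz (EFin \o Phi) J) (luxemburg_norm (EFin \o Phi) J) mu q.
Proof.
exists (C `^ q^-1) => f fPhi /=; rewrite -/(Lap J f).
have [mf _] := fPhi.
have [k k0 intk] := orlicz_unit_scale fPhi.
have [intf mLf Nf] := orlicz_scaled k0 mf intk.
split.
- by move=> z; exact: Lap_integrand_integrable.
- by split=> //; apply: le_lt_trans Nf _; rewrite ltry.
have M0 : 0 < C `^ q^-1 by exact: powR_gt0.
have Nfin : Lq_norm mu q (Lap J f) \is a fin_num.
  by rewrite ge0_fin_numE ?Lnorm_ge0//; apply: le_lt_trans Nf _; rewrite ltry.
rewrite -(fineK Nfin) -lee_pdivrMl// -EFinM.
apply: le_ereal_inf_tmp => _ [l [l0 intl] <-].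
have [_ _] := orlicz_scaled l0 mf intl.
by rewrite -(fineK Nfin) !lee_fin ler_pdivrMl.
Qed.

End from_unit_ball.

Theorem theorem2p14 (R : realType) (q tau0 : R)
    (mu : {measure set (borel (Cplus R)) -> \bar R}) :
  2 <= q -> 0 < tau0 -> regular_measure mu ->
  laplace_bounded `]0, tau0[ (Linfty `]0, tau0[) (Linfty_norm `]0, tau0[) mu q ->
  exists Phi : R -> R, N_function Phi /\
    laplace_bounded `]0, tau0[ (orlicz (EFin \o Phi) `]0, tau0[)
      (luxemburg_norm (EFin \o Phi) `]0, tau0[) mu q.
Proof.
move=> q2 tau0_gt0 _ bdd.
have q0 : 0 < q by exact: lt_le_trans q2.
have J0 : [set` `]0, tau0[] `<=` (`]0, +oo[%classic : set R).
  by move=> t /=; rewrite !in_itv/= andbT => /andP[].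
have Jfin : (lebesgue_measure [set` (`]0%R, tau0[ : interval R)] < +oo)%E.
  by rewrite lebesgue_measure_itv; case: ifP => _; rewrite -?EFinD ltry.
have [K K0 HK] := unit_on_energy q2 bdd.
(* The term [2 `^ q * K] accounts for twice a function bounded by 1; the added 1
   makes [C] positive. *)
pose C := 2 `^ q * K + 1.
have C0 : 0 < C by rewrite ltr_wpDl// mulr_ge0// powR_ge0.
have eps0 j : 0 < C / (2 ^+ (2 * j + 3)) `^ q.
  by rewrite divr_gt0// powR_gt0// exprn_gt0.
have /choice[delta Hdelta] j : exists delta : R, 0 < delta /\
    forall E : set R, measurable E -> (lebesgue_measure E <= delta%:E)%E ->
      (capacity q `]0%R, tau0[ mu E <= (C / (2 ^+ (2 * j + 3)) `^ q)%:E)%E.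
  have [d d0 Hd] := capacity_small q2 J0 Jfin bdd (eps0 j).
  by exists d.
have [Phi [NPhi Phi_homo Phi_half Phi_quad Phi_fast]] :=
  fast_N_function (fun j => (delta j)^-1).
exists Phi; split=> //.
apply: (@laplace_bounded_orlicz R q `]0, tau0[ mu q0 J0 C Phi) => //.
- move=> t t0; apply: le_trans (Phi_quad t t0).
  by rewrite divr_ge0// exprn_ge0.
- move=> f mf intf.
  have KC : 2 `^ q * K <= C by rewrite lerDl.
  have [mLf eLf] := energy_unit_ball q2 J0 Jfin HK C0 KC
    (fun j => (Hdelta j).1) (fun j => (Hdelta j).2) Phi_homo Phi_quad Phi_fast
    mf intf.
  split=> //; exact: (orlicz_integrable Jfin Phi_homo Phi_quad mf intf).
Qed.
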